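(* Let $K$ be a zero-dimensional QWRN compact space. Then $K$ is WRN.
   Context: Compact spaces are Hausdorff. A compact space is zero-dimensional if it has a basis of clopen sets. A compact space is weakly Radon-Nikodým (WRN) if it is homeomorphic to a weak$^*$-compact subset of the dual of a Banach space which does not contain an isomorphic copy of $\ell_1$. A sequence $(A_n^0,A_n^1)_{n\in\mathbb{N}}$ of disjoint pairs of subsets of a set $S$ (i.e. $A_n^0\cap A_n^1=\emptyset$) is independent if for every $n\in\mathbb{N}$ and every $\varepsilon:\{1,\dots,n\}\to\{0,1\}$ we have $\bigcap_{k=1}^nA_k^{\varepsilon(k)}\neq\emptyset$. A family $(A_\alpha^0,A_\alpha^1)_{\alpha\in I}$ of disjoint pairs contains an independent sequence if there is a sequence $(\alpha_n)_{n\in\mathbb{N}}$ in $I$ such that $(A_{\alpha_n}^0,A_{\alpha_n}^1)_{n\in\mathbb{N}}$ is independent. A compact space $K$ is quasi WRN (QWRN) if there exist a set $\Gamma$ and a homeomorphic embedding of $K$ in $[0,1]^\Gamma$ such that for every $\varepsilon>0$ there exists a decomposition $\Gamma=\bigcup_{n\in\mathbb{N}}\Gamma_n^\varepsilon$ such that for all reals $p<q$ with $q-p>\varepsilon$ and every $n\in\mathbb{N}$, the family of pairs $(A_\alpha^0,A_\alpha^1)_{\alpha\in\Gamma_n^\varepsilon}$ does not contain independent sequences, where $A_\alpha^0=\{x\in K:x_\alpha<p\}$, $A_\alpha^1=\{x\in K:x_\alpha>q\}$, and $x_\alpha$ denotes the $\alpha$-th coordinate of the image of $x$ under the embedding. 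*)

(* Defs.v *)
From HB Require Import structures.
From mathcomp Require Import all_boot all_order all_algebra.
From mathcomp Require Import all_classical all_reals all_analysis.

Set Implicit Arguments.
Unset Strict Implicit.
Unset Printing Implicit Defensive.

Import Order.TTheory GRing.Theory Num.Theory.
Import numFieldNormedType.Exports.

Local Open Scope classical_set_scope.
Local Open Scope ring_scope.

Definition homeomorphic (X Y : topologicalType) :=
  exists (f : X -> Y) (g : Y -> X),
    [/\ cancel f g, cancel g f, continuous f & continuous g].

(* A homeomorphism onto its range: the last clause says that f is open as a map
   onto range f with the subspace topology. *)
Definition embedding (X Y : topologicalType) (f : X -> Y) :=
  [/\ injective f, continuous f &
      forall U : set X, open U ->
        exists2 V : set Y, open V & f @` U = range f `&` V].

Definition compact_hausdorff (K : topologicalType) :=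
  compact [set: K] /\ hausdorff_space K.

(* Not the library's [zero_dimensional], which only asks that clopen sets
   separate points. *)
Definition has_clopen_basis (K : topologicalType) :=
  exists2 B : set (set K), B `<=` @clopen K & basis B.

(* No almost-everywhere quotient is needed: the only set that is null for the
   counting measure is empty. *)
Definition ell1 (R : realType) : Type :=
  LfunType (@counting nat R) (lexx 1%E).

HB.instance Definition _ (R : realType) :=
  GRing.Lmodule.copy (ell1 R) (LfunType (@counting nat R) (lexx 1%E)).

Section ell1_norm.
Variable R : realType.

Definition ell1_norm (a : ell1 R) : R :=
  fine ('N[@counting nat R]_1[EFin \o a])%E.

Lemma ell1_normD (a b : ell1 R) :
  ell1_norm (a + b) <= ell1_norm a + ell1_norm b.
Proof. exact: (@ler_LnormD _ _ _ (@counting nat R) 1%E (lexx 1%E) a b). Qed.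

Lemma EFin_ell1_norm (a : ell1 R) :
  (ell1_norm a)%:E = (\sum_(k <oo) `|(a k)%:E|)%E.
Proof.
rewrite /ell1_norm (@finite_norm_fine _ _ _ (@counting nat R) 1%E (lexx 1%E) a).
rewrite Lnorm_counting// invr1 poweRe1; last first.
  by apply: nneseries_ge0 => *; exact: poweR_ge0.
by apply: eq_eseriesr => k _; rewrite poweRe1.
Qed.

Lemma ell1_normZ (l : R) (a : ell1 R) :
  ell1_norm (l *: a) = `|l| * ell1_norm a.
Proof.
apply/EFin_inj; rewrite EFinM !EFin_ell1_norm -nneseriesZl//.
by apply: eq_eseriesr => k _; rewrite -EFinM -normrM.
Qed.

Lemma ell1_norm0_eq0 (a : ell1 R) : ell1_norm a = 0 -> a = 0.
Proof.
move=> a0; apply/LfuneqP => k.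
have sum0 : (\sum_(j <oo) `|(a j)%:E| = 0)%E by rewrite -EFin_ell1_norm a0.
have := @nneseries_lim_ge R (fun j => `|(a j)%:E|%E) xpredT 0 k.+1
  (fun _ _ _ => abse_ge0 _).
rewrite sum0 big_nat_recr//= => le0.
have : (`|(a k)%:E| <= 0)%E by apply: le_trans le0; rewrite leeDr// sume_ge0.
by rewrite lee_fin normr_le0 => /eqP.
Qed.

HB.instance Definition _ := Lmodule_isNormed.Build R (ell1 R)
  ell1_normD ell1_normZ ell1_norm0_eq0.

End ell1_norm.

Definition contains_ell1 (R : realType) (X : normedModType R) :=
  exists T : {linear ell1 R -> X}, embedding T.

(* The dual of X as a subset of the product R^X, so that the subspace topology
   on the type [dual X] is the weak* topology. *)
Definition dual (R : realType) (X : normedModType R) : set {ptws X -> R} :=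
  [set f | scalar (f : X -> R) /\ continuous (f : X -> R)].
Arguments dual {R} X _.

Definition WRN (R : realType) (K : topologicalType) :=
  exists X : completeNormedModType R, ~ contains_ell1 X /\
    exists2 L : set (dual X), compact L & homeomorphic K L.

(* A n false and A n true are the sets A_n^0 and A_n^1, with n counted from 0.
   The case n = 0 of the second clause adds nothing, as it follows from n = 1. *)
Definition independent (S : Type) (A : nat -> bool -> set S) :=
  (forall n, A n false `&` A n true = set0) /\
  forall (n : nat) (eps : 'I_n -> bool),
    \bigcap_(k in [set: 'I_n]) A k (eps k) !=set0.

Definition contains_independent_sequence (S I : Type) (J : set I)
    (A : I -> bool -> set S) :=
  exists2 a : nat -> I, (forall n, J (a n)) & independent (A \o a).

Definition QWRN (R : realType) (K : topologicalType) :=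
  exists (Gamma : Type) (e : K -> {ptws Gamma -> `[(0 : R), 1]%classic}),
    embedding e /\
    forall eps : R, 0 < eps ->
    exists2 G : nat -> set Gamma, [set: Gamma] = \bigcup_n G n &
    forall p q : R, p < q -> eps < q - p ->
    forall n, ~ contains_independent_sequence (G n)
      (fun alpha (i : bool) =>
         if i then [set x : K | q < val (e x alpha)]
         else [set x : K | val (e x alpha) < p]).

(* Main.v *)
(* Finitely many coordinates separate a clopen set from its complement with
   some margin 3/m, so the clopen sets split into countably many classes,
   according to m and to the pieces Gamma_n that contain these coordinates. By
   Rosenthal's dichotomy, the absence of independent sequences makes every
   sequence in one class have a pointwise convergent subsequence.
   Interpolating between the absolutely convex hulls of these classes and the
   sup-norm ball, as Davis, Figiel, Johnson and Pelczynski do, gives a Banach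
   space of continuous functions on K that contains the indicators of clopen
   sets, so that K embeds in its dual by evaluation. If this space contained
   l1, a gliding hump would yield an l1-sequence for the sup norm in the hull
   of a single class. A finitely additive mean on K * {-1,1}^N, given by Hahn-
   Banach, would then correlate infinitely many Rademacher functions with the
   sets of a pointwise convergent sequence, hence with one fixed set,
   contradicting Bessel's inequality. *)
From HB Require Import structures.
Require Import Defs.
From mathcomp Require Import all_boot all_order all_algebra.
From mathcomp Require Import all_classical all_reals all_analysis.
From mathcomp Require Import ring lra.

Set Implicit Arguments.
Unset Strict Implicit.
Unset Printing Implicit Defensive.

Import Order.TTheory GRing.Theory Num.Theory.
Import numFieldNormedType.Exports.

Local Open Scope classical_set_scope.
Local Open Scope ring_scope.

(** * Infinite index sets and their refinement *)

Definition unbounded (M : set nat) :=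
  forall n, exists2 m, M m & (n <= m)%N.

Lemma unbounded_nat : unbounded [set: nat].
Proof. by move=> n; exists n. Qed.

Lemma unbounded_pigeonhole (M : set nat) (C : finType) (c : nat -> C) :
  unbounded M -> exists x, unbounded (M `&` [set k | c k = x]).
Proof.
move=> uM; apply: contrapT => /forallNP nb.
have /choice[b bP] : forall x, exists n, forall m, M m -> (n <= m)%N -> c m <> x.
  move=> x; have /existsNP[n /forall2NP nP] := nb x.
  exists n => m Mm nm cm; have [|//] := nP m.
  by apply; split.
have [m Mm bm] := uM (\max_x b x)%N.
apply: (bP (c m) m Mm) => //.
by apply: leq_trans bm; exact: (leq_bigmax (c m)).
Qed.

(** Refine for one member of [s] after another; heredity preserves what the earlier refinements
    achieved. *)
Lemma finite_refinement (T : eqType) (P : T -> set nat -> Prop) (s : seq T)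
    (M : set nat) :
  (forall x M M', P x M -> M' `<=` M -> P x M') ->
  (forall x M, unbounded M ->
     exists M', [/\ unbounded M', M' `<=` M & P x M']) ->
  unbounded M ->
  exists M', [/\ unbounded M', M' `<=` M & {in s, forall x, P x M'}].
Proof.
move=> her ref; elim: s M => [|x s IH] M uM; first by exists M; split => // x.
have [M1 [uM1 sM1 P1]] := ref x _ uM.
have [M2 [uM2 sM2 P2]] := IH _ uM1.
exists M2; split => //; first exact: (subset_trans _ sM1).
move=> y; rewrite inE => /predU1P[->|/P2//].
exact: her P1 sM2.
Qed.

(** * Rosenthal's dichotomy for sequences of pairs of sets *)

Section rosenthal.
Variables (S : Type) (A : nat -> bool -> set S).

(* No point lies in [A n false] for infinitely many n in M and in [A n true]
   for infinitely many n in M. *)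
Definition pairs_converge_at (M : set nat) (s : S) :=
  exists b : bool, exists n, forall m, M m -> (n <= m)%N -> ~ A m b s.

Lemma pairs_converge_at_almost_sub (M M' : set nat) (s : S) (n : nat) :
  (forall m, M' m -> (n <= m)%N -> M m) ->
  pairs_converge_at M s -> pairs_converge_at M' s.
Proof.
move=> M'M [b [k bk]]; exists b, (maxn n k) => m M'm.
by rewrite geq_max => /andP[nm km]; apply: bk => //; exact: M'M.
Qed.

(** The invariant of the tree construction below: it passes to subsets of [M], and for infinite [M]
    it forces [X] to be nonempty, since convergence on the empty set is vacuous. *)
Definition pairs_nowhere_converge (M : set nat) (X : set S) :=
  forall M', unbounded M' -> M' `<=` M ->
    ~ (forall s, X s -> pairs_converge_at M' s).

(** Diagonal argument. If no index splits all the [X i], there are decreasing sets [st k] and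
    indices [J k] in [st k] such that [st k.+1] converges on the part of some [X i] in [A (J k) b].
    One pair [(i, b)] recurs infinitely often, and its indices converge on [X i]: a point in one of
    their sets [A (J k) b] is governed by [st k.+1], and any other point avoids them all. *)
Lemma pairs_nowhere_converge_split (I : finType) (X : I -> set S) (M : set nat) :
  unbounded M -> (forall i, pairs_nowhere_converge M (X i)) ->
  exists j, exists M', [/\ M j, unbounded M', M' `<=` M &
    forall i b, pairs_nowhere_converge M' (X i `&` A j b)].
Proof.
move=> uM nX; apply: contrapT => H.
have step (p : set nat * nat) : exists q : set nat * (nat * (I * bool)),
    unbounded p.1 -> p.1 `<=` M ->
    [/\ q.1 `<=` p.1, unbounded q.1, p.1 q.2.1, (p.2 <= q.2.1)%N &
      forall s, (X q.2.2.1 `&` A q.2.1 q.2.2.2) s -> pairs_converge_at q.1 s].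
  case: p => N k; have [[uN sN]|nN] := pselect (unbounded N /\ N `<=` M); last first.
    (* An element of [I] serves as a default value; for empty [I] the claim is trivial. *)
    have [i0 _] : exists i : I, True.
      by apply: contrapT => nI; apply: H; have [j Mj _] := uM 0%N; exists j, M;
        split => // i; case: nI; exists i.
    by exists (N, (0%N, (i0, true))) => /= uN sN; case: nN.
  have [j Nj kj] := uN k.
  apply: contrapT => nq; apply: H; exists j, N; split => //; first exact: sN.
  move=> i b N' uN' N'N cv; apply: nq; exists (N', (j, (i, b))) => _ _.
  by split.
have [F FP] := choice step.
pose st := fix st k := if k is k'.+1 then (F (st k', k')).1 else M.
pose J k := (F (st k, k)).2.1.
pose c k := (F (st k, k)).2.2.
have stP k : unbounded (st k) /\ st k `<=` M.
  elim: k => [|k [u1 s1]]; first by split=> /=.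
  have [/= a1 a2 _ _ _] := FP (st k, k) u1 s1.
  by split => //; exact: subset_trans s1.
have stS k l : (k <= l)%N -> st l `<=` st k.
  elim: l => [|l IH]; first by rewrite leqn0 => /eqP ->.
  rewrite leq_eqVlt => /predU1P[->//|]; rewrite ltnS => /IH; apply: subset_trans.
  by have [u1 s1] := stP l; have [] := FP (st l, l) u1 s1.
have Jst k : st k (J k) by have [u1 s1] := stP k; have [] := FP (st k, k) u1 s1.
have Jk k : (k <= J k)%N by have [u1 s1] := stP k; have [] := FP (st k, k) u1 s1.
have cP k s :
    (X (c k).1 `&` A (J k) (c k).2) s -> pairs_converge_at (st k.+1) s.
  by have [u1 s1] := stP k; have [_ _ _ _] := FP (st k, k) u1 s1; apply.
have [[i b] uib] := unbounded_pigeonhole c unbounded_nat.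
pose N := [set j | exists2 k, c k = (i, b) & j = J k].
apply: (nX i N).
- move=> n; have [k [_ /= ck] nk] := uib n; exists (J k); first by exists k.
  exact: leq_trans (Jk k).
- by move=> _ [k _ ->]; have [_ sk] := stP k; exact/sk/Jst.
move=> s Xs; have [[k ck Ak]|nA] := pselect (exists2 k, c k = (i, b) & A (J k) b s).
  have cv : pairs_converge_at (st k.+1) s by apply: cP; rewrite ck.
  (* Beyond the largest of [J 0], ..., [J k], every index in [N] is some [J l] with [l > k], hence
     lies in [st k.+1]. *)
  apply: (pairs_converge_at_almost_sub (n := (\max_(i < k.+1) J i).+1)) cv.
  move=> _ [l _ ->] lm; apply: (stS _ l _ _ (Jst l)).
  rewrite ltnNge; apply/negP => lk; move: lm; apply/negP; rewrite -ltnNge ltnS.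
  by have := leq_bigmax (F := fun i : 'I_k.+1 => J i) (inord l); rewrite inordK.
exists b, 0%N => _ [k ck ->] _ Ak; apply: nA; by exists k.
Qed.

Let cell (js : seq nat) (eps : nat -> bool) : set S :=
  [set s | forall i, (i < size js)%N -> A (nth 0%N js i) (eps i) s].

(** If no subsequence converges, the splitting lemma is iterated on the cells of the indices found
    so far. All cells stay nowhere convergent, hence nonempty. *)
Lemma rosenthal_dichotomy (M : set nat) : unbounded M ->
  (exists M', [/\ unbounded M', M' `<=` M & forall s, pairs_converge_at M' s]) \/
  (exists2 a : nat -> nat, forall n, M (a n) &
     forall (n : nat) (eps : 'I_n -> bool),
       \bigcap_(k in [set: 'I_n]) A (a k) (eps k) !=set0).
Proof.
move=> uM; have [?|nconv] := pselect (exists M', [/\ unbounded M', M' `<=` M &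
  forall s, pairs_converge_at M' s]); [by left|right].
pose good js := exists M', [/\ unbounded M', M' `<=` M &
  forall eps, pairs_nowhere_converge M' (cell js eps)].
have good0 : good [::].
  exists M; split => // eps M' uM' M'M cv; apply: nconv; exists M'.
  by split => // s; exact: cv.
have goodS js : exists j, good js -> M j /\ good (rcons js j).
  have [[M1 [uM1 sM1 c1]]|ng] := pselect (good js); last by exists 0%N.
  (* A cell depends on the first [size js] signs only, so finitely many tuples account for all
     cells. *)
  have [j [M2 [M1j uM2 sM2 c2]]] := @pairs_nowhere_converge_split
    ((size js).-tuple bool) (fun t => cell js (nth false t)) M1 uM1
    (fun t => c1 (nth false t)).
  exists j => _; split; first exact: sM1.
  exists M2; split => //; first exact: (subset_trans _ sM1).
  move=> eps M' uM' sM' cv.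
  apply: (c2 [tuple eps i | i < size js] (eps (size js)) M' uM' sM').
  move=> s [cs As]; apply: cv => i; rewrite size_rcons ltnS leq_eqVlt.
  rewrite nth_rcons => /predU1P[->|ij]; first by rewrite ltnn eqxx.
  have := cs i ij; rewrite ij -[i]/(val (Ordinal ij)) -tnth_nth tnth_mktuple; exact.
have [f fP] := choice goodS.
pose g := fix g n := if n is n'.+1 then rcons (g n') (f (g n')) else [::].
pose a n := f (g n).
have gE n : g n = mkseq a n.
  by elim: n => // n IH; rewrite mkseqS /= -IH.
have gg n : good (g n) by elim: n => //= n /fP[].
exists a; first by move=> n; have [] := fP _ (gg n).
move=> n eps; have [M' [uM' sM' c]] := gg n.
pose e i := if insub i is Some k then eps k else false.
have [s cs] : cell (g n) e !=set0.
  apply/set0P/negP => /eqP c0; apply: (c e M') => // s.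
  by rewrite c0.
exists s => k _; have := cs k; rewrite gE size_mkseq ltn_ord nth_mkseq//.
by rewrite /e valK; exact.
Qed.

End rosenthal.

(** * Hahn-Banach theorem for sublinear functionals on a subspace *)

Lemma le_mul_inf (R : realType) (E : set R) (z s : R) :
  0 <= s -> E !=set0 -> (forall e, E e -> z <= s * e) -> z <= s * inf E.
Proof.
move=> s0 E0 zE; have [s00|sN0] := eqVneq s 0.
  by have [e Ee] := E0; have := zE _ Ee; rewrite s00 !mul0r.
have sp : 0 < s by rewrite lt_neqAle eq_sym sN0.
rewrite mulrC -ler_pdivrMr//; apply: lb_le_inf => // e Ee.
by rewrite ler_pdivrMr// mulrC; exact: zE.
Qed.

Section hahn_banach.
Variables (R : realType) (V : lmodType R) (D : set V).
Hypotheses (D0 : D 0) (DD : forall u v, D u -> D v -> D (u + v)).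
Hypothesis DZ : forall (t : R) u, D u -> D (t *: u).

(** Homogeneity is asked as an inequality, which passes to infima directly; equality follows on
    scaling back ([sublinear_onZ]). *)
Definition sublinear_on (q : V -> R) :=
  (forall u v, D u -> D v -> q (u + v) <= q u + q v) /\
  (forall (t : R) u, 0 <= t -> D u -> q (t *: u) <= t * q u).

Let DN u : D u -> D (- u).
Proof. by move=> Du; rewrite -scaleN1r; exact: DZ. Qed.

Lemma sublinear_on0 q : sublinear_on q -> q 0 = 0.
Proof.
move=> [qD qZ]; apply/eqP; rewrite eq_le; apply/andP; split.
  by have := qZ 0 0 (lexx _) D0; rewrite scale0r mul0r.
by have := qD 0 0 D0 D0; rewrite addr0 -[leLHS]addr0 lerD2l.
Qed.

Lemma sublinear_onN_ge q u : sublinear_on q -> D u -> - q (- u) <= q u.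
Proof.
move=> sq Du; have [qD _] := sq; have := qD _ _ Du (DN Du).
by rewrite subrr (sublinear_on0 sq); lra.
Qed.

Lemma sublinear_onZ q t u :
  sublinear_on q -> 0 <= t -> D u -> q (t *: u) = t * q u.
Proof.
move=> sq; have [_ qZ] := sq; rewrite le_eqVlt => /predU1P[<- Du|t0 Du].
  by rewrite scale0r mul0r (sublinear_on0 sq).
apply/eqP; rewrite eq_le qZ ?(ltW t0)//=.
have ti0 : 0 < t^-1 by rewrite invr_gt0.
have := qZ t^-1 _ (ltW ti0) (DZ t Du); rewrite scalerA mulVf ?gt_eqF// scale1r.
by rewrite [leRHS]mulrC ler_pdivlMr// [leLHS]mulrC.
Qed.

(** Two functionals nearly optimal at [u] and at [v] have a common minorant in [A], which makes the
    infimum subadditive. The bound [p] keeps it finite, as [- p (- u) <= - q (- u) <= q u]. *)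
Lemma sublinear_on_inf (A : set (V -> R)) (p : V -> R) :
  A !=set0 -> (forall q, A q -> sublinear_on q) ->
  (forall q, A q -> forall u, D u -> q u <= p u) ->
  (forall q1 q2, A q1 -> A q2 -> exists2 q, A q &
     forall u, D u -> q u <= q1 u /\ q u <= q2 u) ->
  let r u := inf [set q u | q in A] in
  sublinear_on r /\ forall q, A q -> forall u, D u -> r u <= q u.
Proof.
move=> [q0 Aq0] Asub Ap Adir r.
have lb u : D u -> has_lbound [set q u | q in A].
  move=> Du; exists (- p (- u)) => _ [q Aq <-].
  apply: le_trans (sublinear_onN_ge (Asub _ Aq) Du).
  by rewrite lerN2; exact/Ap/DN.
have ne u : [set q u | q in A] !=set0 by exists (q0 u), q0.
have rle q : A q -> forall u, D u -> r u <= q u.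
  by move=> Aq u Du; apply: ge_inf; [exact: lb|exists q].
split=> //; split=> [u v Du Dv|t u t0 Du].
  rewrite -lerBlDr; apply: lb_le_inf => // _ [q1 Aq1 <-].
  rewrite lerBlDr -lerBlDl; apply: lb_le_inf => // _ [q2 Aq2 <-].
  have [q Aq qle] := Adir _ _ Aq1 Aq2; rewrite lerBlDl.
  apply: (le_trans (rle _ Aq _ (DD Du Dv))).
  apply: le_trans ((Asub _ Aq).1 _ _ Du Dv) _.
  by apply: lerD; [exact: (qle _ Du).1|exact: (qle _ Dv).2].
apply: le_mul_inf => // _ [q Aq <-].
apply: (le_trans (rle _ Aq _ (DZ t Du))).
exact: (Asub _ Aq).2.
Qed.

(** Zorn's lemma for the reversed pointwise order on [D]; a nonempty chain is bounded by its
    pointwise infimum. *)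
Lemma minimal_sublinear_on (p : V -> R) : sublinear_on p ->
  exists q, [/\ sublinear_on q, forall u, D u -> q u <= p u &
    forall r, sublinear_on r -> (forall u, D u -> r u <= q u) ->
      forall u, D u -> q u <= r u].
Proof.
move=> sp.
pose T := {q | sublinear_on q /\ forall u, D u -> q u <= p u}.
pose Rel (q1 q2 : T) := `[< forall u, D u -> sval q2 u <= sval q1 u >].
have p0 : T by exists p.
have [|||q qmin] := @ZL_preorder T p0 Rel.
- by move=> q; apply/asboolP => u _.
- move=> q1 q2 q3 /asboolP h1 /asboolP h2; apply/asboolP => u Du.
  exact: le_trans (h2 _ Du) (h1 _ Du).
- move=> A Atot; have [->|/set0P[a0 Aa0]] := eqVneq A set0; first by exists p0.
  have [//||||/= sr rle] := @sublinear_on_inf [set sval q | q in A] p.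
  + by exists (sval a0), a0.
  + by move=> _ [q _ <-]; exact: (svalP q).1.
  + by move=> _ [q _ <-]; exact: (svalP q).2.
  + move=> _ _ [q1 A1 <-] [q2 A2 <-].
    have [/asboolP h|/asboolP h] := Atot _ _ A1 A2.
      by exists (sval q2); [exists q2|move=> u Du; split=> //; exact: h].
    by exists (sval q1); [exists q1|move=> u Du; split=> //; exact: h].
  set r := (fun u => inf _) in sr rle.
  have rp u : D u -> r u <= p u.
    move=> Du; apply: le_trans ((svalP a0).2 _ Du).
    by apply: rle => //; exists a0.
  exists (exist _ r (conj sr rp)) => q Aq; apply/asboolP => u Du /=.
  by apply: rle => //; exists q.
exists (sval q); split; [exact: (svalP q).1|exact: (svalP q).2|].
move=> r sr rq.
have rp u : D u -> r u <= p u.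
  by move=> Du; exact: le_trans (rq _ Du) ((svalP q).2 _ Du).
by have /(_ _)/asboolP := qmin (exist _ r (conj sr rp)); apply; exact/asboolP.
Qed.

(* A minimal sublinear functional q is linear: subtracting off the direction y
   as much as possible gives a smaller sublinear functional, hence q itself. *)
Lemma hahn_banach_on (p : V -> R) : sublinear_on p ->
  exists L : V -> R, [/\ forall u, D u -> L u <= p u,
    forall u v, D u -> D v -> L (u + v) = L u + L v &
    forall t u, D u -> L (t *: u) = t * L u].
Proof.
move=> /minimal_sublinear_on[q [sq qp qmin]]; have [qD qZ] := sq.
have qadd u v : D u -> D v -> q (u + v) = q u + q v.
  move=> Du Dy; apply/eqP; rewrite eq_le qD//=.
  pose E x := [set q (x + t *: v) - t * q v | t in [set t | 0 <= t]].
  pose r x := inf (E x).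
  have E0 x : E x !=set0 by exists (q (x + 0 *: v) - 0 * q v), 0 => /=.
  have Elb x : D x -> has_lbound (E x).
    move=> Dx; exists (- q (- x)) => _ [t /= t0 <-].
    have Dt := DZ t Dy.
    have := qD (x + t *: v) (- x) (DD Dx Dt) (DN Dx).
    by rewrite addrAC subrr add0r (sublinear_onZ sq)//; lra.
  have rle x t : D x -> 0 <= t -> r x <= q (x + t *: v) - t * q v.
    by move=> Dx t0; apply: ge_inf; [exact: Elb|exists t].
  have sr : sublinear_on r.
    split=> [x y Dx Dy'|s x s0 Dx].
      rewrite -lerBlDr; apply: lb_le_inf => // _ [t /= t0 <-].
      rewrite lerBlDr -lerBlDl; apply: lb_le_inf => // _ [t' /= t'0 <-].
      have := rle (x + y) (t + t') (DD Dx Dy') (addr_ge0 t0 t'0).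
      have := qD _ _ (DD Dx (DZ t Dy)) (DD Dy' (DZ t' Dy)).
      by rewrite scalerDl addrACA; lra.
    apply: le_mul_inf => // _ [t /= t0 <-].
    have := rle (s *: x) (s * t) (DZ s Dx) (mulr_ge0 s0 t0).
    rewrite -scalerA -scalerDr => /le_trans; apply.
    rewrite mulrBr mulrA lerB//; apply: qZ => //.
    by apply: DD => //; exact: DZ.
  have rq x : D x -> r x <= q x.
    by move=> Dx; have := rle x 0 Dx (lexx _); rewrite scale0r addr0 mul0r subr0.
  (* Minimality gives [q u <= r u], and the term [t = 1] of the infimum gives
     [r u <= q (u + v) - q v]. *)
  have := qmin r sr rq u Du; have := rle u 1 Du ler01.
  by rewrite scale1r mul1r; lra.
have qN u : D u -> q (- u) = - q u.
  move=> Du; have := qadd u (- u) Du (DN Du).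
  by rewrite subrr (sublinear_on0 sq); lra.
exists q; split=> // t u Du; have [t0|t0] := leP 0 t.
  exact: sublinear_onZ.
rewrite -[t in LHS]opprK scaleNr qN; last exact: DZ.
by rewrite (sublinear_onZ sq)// ?oppr_ge0 1?ltW//; ring.
Qed.

End hahn_banach.

(** * Finitely additive means on bounded functions *)

Section mean.
Variables (R : realType) (W : Type).
Implicit Types f g u : W -> R.

Definition bounded_fct f := exists B, forall w, `|f w| <= B.

Lemma bounded_fct_cst (c : R) : bounded_fct (fun=> c).
Proof. by exists `|c|. Qed.

Lemma bounded_fctD f g :
  bounded_fct f -> bounded_fct g -> bounded_fct (fun w => f w + g w).
Proof.
move=> [B fB] [C gC]; exists (B + C) => w.
by apply: le_trans (ler_normD _ _) _; exact: lerD.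
Qed.

Lemma bounded_fctM f g :
  bounded_fct f -> bounded_fct g -> bounded_fct (fun w => f w * g w).
Proof.
move=> [B fB] [C gC]; exists (B * C) => w.
by rewrite normrM; apply: ler_pM.
Qed.

Lemma bounded_fctZ (c : R) f : bounded_fct f -> bounded_fct (fun w => c * f w).
Proof. by apply: bounded_fctM; exact: bounded_fct_cst. Qed.

(** A finitely additive probability on all subsets of [W], given as its integral; values at
    unbounded functions are arbitrary. *)
Record is_mean (L : (W -> R) -> R) := IsMean {
  meanD : forall f g, bounded_fct f -> bounded_fct g ->
    L (fun w => f w + g w) = L f + L g;
  meanZ : forall c f, bounded_fct f -> L (fun w => c * f w) = c * L f;
  mean_ge0 : forall f, bounded_fct f -> (forall w, 0 <= f w) -> 0 <= L f;
  mean1 : L (fun=> 1) = 1 }.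

(** Hahn-Banach for the functional [p] that takes [f] to the infimum over [u] in [U] of the supremum
    of [f + u]. It is finite because no member of the cone [U] is uniformly negative, and for [f] in
    [U] the choice [u = f] gives [p (- f) <= 0]. *)
Lemma exists_mean (U : set (W -> R)) :
  U (fun=> 0) -> (forall f g, U f -> U g -> U (fun w => f w + g w)) ->
  (forall t f, 0 <= t -> U f -> U (fun w => t * f w)) ->
  (forall f, U f -> bounded_fct f) ->
  (forall f c, U f -> 0 < c -> ~ (forall w, f w <= - c)) ->
  exists2 L, is_mean L & forall f, U f -> 0 <= L f.
Proof.
move=> U0 UD UZ Ub Ucone.
pose E f := [set r | exists2 u, U u & forall w, f w + u w <= r].
pose p f := inf (E f).
have E0 f : bounded_fct f -> E f !=set0.
  move=> [B fB]; exists B, (fun=> 0) => // w.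
  by rewrite addr0 (le_trans (ler_norm _)).
have Elb f : bounded_fct f -> has_lbound (E f).
  move=> [B fB]; exists (- B) => r [u Uu fur].
  rewrite leNgt; apply/negP => rB; apply: (Ucone u (- B - r) Uu).
    by rewrite subr_gt0.
  by move=> w; have := fur w; have := fB w; rewrite ler_norml => /andP[]; lra.
have ple f r u : bounded_fct f -> U u -> (forall w, f w + u w <= r) -> p f <= r.
  by move=> bf Uu fr; apply: ge_inf; [exact: Elb|exists u].
have sp : sublinear_on (V := W -> R^o) [set f | bounded_fct f] p.
  split=> [f g bf bg|t f t0 bf].
    rewrite -lerBlDr; apply: lb_le_inf; first exact: E0.
    move=> r [u Uu fr]; rewrite lerBlDr -lerBlDl; apply: lb_le_inf; first exact: E0.
    move=> s [v Uv gs]; rewrite lerBlDl.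
    apply: ple (UD _ _ Uu Uv) _; first exact: bounded_fctD.
    by move=> w; rewrite addrACA; exact: lerD.
  apply: le_mul_inf => //; first exact: E0.
  move=> r [u Uu fr]; apply: ple (UZ t _ t0 Uu) _; first exact: bounded_fctZ.
  by move=> w; rewrite -mulrDr ler_wpM2l.
have [|f g bf bg|t f bf|L [Lp LD LZ]] := hahn_banach_on _ _ _ sp.
- exact: bounded_fct_cst.
- exact: bounded_fctD.
- exact: bounded_fctZ.
have LN f : bounded_fct f -> L (fun w => - f w) = - L f.
  by move=> bf; have := LZ (-1) f bf; rewrite scaleN1r mulN1r.
have Lle f r u : bounded_fct f -> U u -> (forall w, f w + u w <= r) -> L f <= r.
  by move=> bf Uu fr; apply: le_trans (Lp f bf) _; exact: ple fr.
have bN f : bounded_fct f -> bounded_fct (fun w => - f w).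
  by move=> [B fB]; exists B => w; rewrite normrN.
exists L; first split=> [f g bf bg|c f bf|f bf f0|].
- exact: LD.
- exact: LZ.
- rewrite -oppr_le0 -LN//; apply: Lle U0 _; first exact: bN.
  by move=> w; rewrite addr0 oppr_le0.
- have b1 := bounded_fct_cst 1.
  apply/eqP; rewrite eq_le (Lle _ _ _ b1 U0) => [|w]; last by rewrite addr0.
  rewrite -lerN2 -LN//; apply: Lle U0 _; first exact: bN.
  by move=> w; rewrite addr0.
move=> f Uf; have bf := Ub f Uf; rewrite -oppr_le0 -LN//.
by apply: Lle Uf _; [exact: bN|move=> w; rewrite addNr].
Qed.

End mean.

(** * Finitely additive set functions on a compact space *)

Section finitely_additive_compact.
Variables (R : realType) (K : topologicalType).
Hypothesis cK : compact [set: K].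

Lemma decreasing_closed_nonempty (F : nat -> set K) :
  (forall n, closed (F n)) ->
  (forall n, exists x, forall k, (k <= n)%N -> F k x) ->
  exists x, forall n, F n x.
Proof.
move=> cF ne; pose G n := [set x | forall k, (k <= n)%N -> F k x].
have GF : ProperFilter (filter_from [set: nat] G).
  apply: filter_from_proper => [|n _]; last exact: ne.
  apply: filter_from_filter; first by exists 0%N.
  move=> i j _ _; exists (maxn i j) => // x Gx.
  by split=> k ki; apply: Gx; rewrite leq_max ki ?orbT.
have [x [_ xcl]] := cK GF (filterT).
exists x => n; apply: cF => B xB; apply: xcl => //.
by exists n => // y; exact.
Qed.

(* Fatou for a finitely additive mu: by compactness it behaves like a
   countably additive measure on closed sets. *)
Lemma finitely_additive_limsup (mu : set K -> R) (C : R) (D : nat -> set K)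
    (delta : R) :
  (forall A B, A `<=` B -> mu A <= mu B) ->
  (forall A B, A `&` B = set0 -> mu (A `|` B) = mu A + mu B) ->
  mu set0 = 0 -> (forall A, mu A <= C) ->
  (forall n, closed (D n)) -> 0 < delta -> (forall n, delta <= mu (D n)) ->
  exists x, forall n, exists2 i, (n <= i)%N & D i x.
Proof.
move=> mu_le muU mu0 muC cD delta0 Ddelta.
have muU_le A B : mu (A `|` B) <= mu A + mu B.
  have -> : A `|` B = A `|` (B `\` A) by rewrite setDE setUIr setUv setIT.
  rewrite muU ?setDIK// lerD2l; apply: mu_le; exact: subDsetl.
have muD A B : B `<=` A -> mu (A `\` B) = mu A - mu B.
  move=> BA; rewrite -{2}(setDUK BA) muU; first by rewrite addrAC subrr add0r.
  exact: setDIK.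
pose U n m := [set x | exists i, [/\ (n <= i)%N, (i < m)%N & D i x]].
pose s n := sup [set mu (U n m) | m in [set: nat]].
pose d n : R := delta / 2 ^+ n.+1.
have d0 n : 0 < d n by rewrite divr_gt0// exprn_gt0.
have hs n : has_sup [set mu (U n m) | m in [set: nat]].
  split; first by exists (mu (U n 0%N)), 0%N.
  by exists C => _ [m _ <-].
have les n m : mu (U n m) <= s n.
  by apply: ub_le_sup; [exact: (hs n).2|exists m].
(* [F n] is a finite union of sets [D i] with [i >= n] that misses at most [d n] of any other such
   union; finitely many of these losses add up to less than [delta]. *)
have /choice[m mP] n : exists m, s n - d n < mu (U n m).
  by have [_ [m _ <-]] := sup_adherent (d0 n) (hs n); exists m.
pose F n := U n (m n).
have UF n k : mu (U n k `\` F n) <= d n.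
  apply: (@le_trans _ _ (mu (U n (maxn k (m n)) `\` F n))).
    apply: mu_le => x [[i [ni ik Dx]] nF]; split => //.
    by exists i; split=> //; rewrite leq_max ik.
  rewrite muD => [|x [i [ni ik Dx]]]; last first.
    by exists i; split=> //; rewrite leq_max ik orbT.
  by have := mP n; have := les n (maxn k (m n)); rewrite /F; lra.
pose G n := [set x | forall k, (k <= n)%N -> F k x].
have UG n : forall k, mu (U n k `\` G n) <= \sum_(i < n.+1) d i.
  elim: n => [|n IH] k.
    rewrite big_ord_recr big_ord0/= add0r; apply: le_trans (UF 0%N k).
    apply: mu_le => x [Ux nG]; split=> // Fx; apply: nG => i.
    by rewrite leqn0 => /eqP ->.
  rewrite big_ord_recr/=; apply: le_trans (lerD (IH k) (UF n.+1 k)).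
  apply: le_trans (muU_le _ _); apply: mu_le => x [Ux nG].
  have [Fx|nF] := pselect (F n.+1 x); [left|by right].
  split.
    by have [i [ni ik Dx]] := Ux; exists i; split=> //; exact: ltnW.
  move=> Gx; apply: nG => i; rewrite leq_eqVlt => /predU1P[->//|].
  by rewrite ltnS; exact: Gx.
have sumd n : \sum_(i < n) d i = delta - delta / 2 ^+ n.
  elim: n => [|n IH]; first by rewrite big_ord0 expr0 divr1 subrr.
  rewrite big_ord_recr/= IH /d exprS; field.
  by rewrite expf_neq0.
have Fclosed n : closed (F n).
  rewrite /F; elim: (m n) => [|k IH].
    rewrite (_ : U _ _ = set0); first exact: closed0.
    by apply/seteqP; split=> // x [i []].
  have [nk|kn] := leqP n k.
    rewrite (_ : U _ _ = U n k `|` D k); first exact: closedU.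
    apply/seteqP; split=> [x [i [ni]]|x [[i [ni ik Dx]]|Dx]].
    - rewrite ltnS leq_eqVlt => /predU1P[->|ik Dx]; first by right.
      by left; exists i.
    - by exists i; split=> //; exact: ltnW.
    - by exists k.
  rewrite (_ : U _ _ = U n k) //.
  apply/seteqP; split=> x [i [ni ik Dx]]; last by exists i; split=> //; exact: ltnW.
  by have := leq_trans (leq_ltn_trans ni ik) kn; rewrite ltnn.
have [n|x Fx] := decreasing_closed_nonempty Fclosed; last first.
  by exists x => n; have [i [ni _ Dx]] := Fx n; exists i.
(* If [G n] were empty, all of [D n] would be lost, although its measure is at least [delta]. *)
apply: contrapT => nG.
have : mu (D n) <= \sum_(i < n.+1) d i.
  apply: le_trans (UG n n.+1); apply: mu_le => x Dx; split.
    by exists n.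
  by move=> Gx; apply: nG; exists x.
have := Ddelta n; rewrite sumd.
have : 0 < delta / 2 ^+ n.+1 by rewrite divr_gt0// exprn_gt0.
lra.
Qed.

End finitely_additive_compact.

(** * Bessel's inequality for means *)

Section mean_theory.
Variables (R : realType) (W : Type) (L : (W -> R) -> R).
Hypothesis mL : is_mean L.
Implicit Types f g : W -> R.

Lemma mean0 : L (fun=> 0) = 0.
Proof.
have b0 := bounded_fct_cst W (0 : R); have := meanZ mL 0 b0.
by rewrite !mul0r.
Qed.

Lemma meanB f g : bounded_fct f -> bounded_fct g ->
  L (fun w => f w - g w) = L f - L g.
Proof.
move=> bf bg; rewrite -mulN1r -(meanZ mL)// -(meanD mL)//; last exact: bounded_fctZ.
by congr L; apply/funext => w; rewrite mulN1r.
Qed.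

Lemma bounded_fctB f g : bounded_fct f -> bounded_fct g ->
  bounded_fct (fun w => f w - g w).
Proof.
move=> bf bg; have := bounded_fctD bf (bounded_fctZ (-1) bg).
by under eq_fun do rewrite mulN1r.
Qed.

Lemma le_mean f g : bounded_fct f -> bounded_fct g ->
  (forall w, f w <= g w) -> L f <= L g.
Proof.
move=> bf bg fg; rewrite -subr_ge0 -meanB//; apply: mean_ge0 => //.
  exact: bounded_fctB.
by move=> w; rewrite subr_ge0.
Qed.

Lemma mean_norm_le f g : bounded_fct f -> bounded_fct g ->
  (forall w, `|f w| <= g w) -> `|L f| <= L g.
Proof.
move=> bf bg fg; rewrite ler_norml; apply/andP; split.
  rewrite -mulN1r -(meanZ mL)//; apply: le_mean => //; first exact: bounded_fctZ.
  by move=> w; rewrite mulN1r; have := fg w; rewrite ler_norml => /andP[].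
by apply: le_mean => // w; have := fg w; rewrite ler_norml => /andP[].
Qed.

Lemma bounded_fct_sum (I : Type) (r : seq I) (F : I -> W -> R) :
  (forall i, bounded_fct (F i)) -> bounded_fct (fun w => \sum_(i <- r) F i w).
Proof.
move=> bF; elim: r => [|i r IH].
  by under eq_fun do rewrite big_nil; exact: bounded_fct_cst.
by under eq_fun do rewrite big_cons; exact: bounded_fctD.
Qed.

Lemma mean_sum (I : Type) (r : seq I) (F : I -> W -> R) :
  (forall i, bounded_fct (F i)) ->
  L (fun w => \sum_(i <- r) F i w) = \sum_(i <- r) L (F i).
Proof.
move=> bF; elim: r => [|i r IH].
  by under eq_fun do rewrite big_nil; rewrite big_nil mean0.
under eq_fun do rewrite big_cons.
by rewrite big_cons (meanD mL) ?IH//; exact: bounded_fct_sum.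
Qed.

(** The remainder [g k] of [f] after [k] projections satisfies the Pythagorean identity [gS], and
    its square has nonnegative mean. *)
Lemma mean_bessel (r : nat -> W -> R) f (n : nat) :
  (forall j, bounded_fct (r j)) -> (forall j w, r j w ^+ 2 = 1) ->
  (forall i j, i != j -> L (fun w => r i w * r j w) = 0) ->
  bounded_fct f ->
  \sum_(j < n) L (fun w => f w * r j w) ^+ 2 <= L (fun w => f w ^+ 2).
Proof.
move=> br r1 ro bf; set c := fun j => L (fun w => f w * r j w).
pose g k w := f w - \sum_(j < k) c j * r j w.
have bg k : bounded_fct (g k).
  by apply: bounded_fctB => //; apply: bounded_fct_sum => j; exact: bounded_fctZ.
have bgg k : bounded_fct (fun w => g k w ^+ 2).
  by under eq_fun do rewrite expr2; exact: bounded_fctM.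
have gr k l : (k <= l)%N -> L (fun w => g k w * r l w) = c l.
  elim: k => [|k IH] kl.
    by congr L; apply/funext => w; rewrite /g big_ord0 subr0.
  rewrite -(IH (ltnW kl)); have /ro rkl : k != l by rewrite ltn_eqF.
  under eq_fun do rewrite /g big_ord_recr/= opprD addrA mulrBl -mulrA.
  rewrite meanB; [|exact: (bounded_fctM (bg k))|by apply/bounded_fctZ/bounded_fctM].
  by rewrite (meanZ mL); [rewrite rkl mulr0 subr0|exact: bounded_fctM].
have gS k : L (fun w => g k w ^+ 2) = L (fun w => f w ^+ 2) - \sum_(j < k) c j ^+ 2.
  elim: k => [|k IH].
    by rewrite big_ord0 subr0; congr L; apply/funext => w; rewrite /g big_ord0 subr0.
  rewrite big_ord_recr/= opprD addrA -IH.
  have -> : (fun w => g k.+1 w ^+ 2) =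
      (fun w => g k w ^+ 2 - (2 * c k * (g k w * r k w) - c k ^+ 2 * 1)).
    apply/funext => w; rewrite -[X in c k ^+ 2 * X](r1 k w) /g big_ord_recr/=; ring.
  rewrite meanB//; last first.
    apply: bounded_fctB; apply: bounded_fctZ; first exact: bounded_fctM.
    exact: bounded_fct_cst.
  rewrite meanB; [|by apply/bounded_fctZ/bounded_fctM|
    exact/bounded_fctZ/bounded_fct_cst].
  rewrite !(meanZ mL); [|exact: bounded_fct_cst|exact: bounded_fctM].
  by rewrite gr// (mean1 mL); ring.
have : 0 <= L (fun w => g n w ^+ 2) by apply: (mean_ge0 mL) => // w; exact: sqr_ge0.
by rewrite gS subr_ge0.
Qed.

End mean_theory.

(** * Rademacher functions and a mean that correlates with them *)

Section rademacher.
Variables (R : realType) (K : Type).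

Definition rademacher (j : nat) (w : K * (nat -> bool)) : R := (-1) ^+ w.2 j.

Lemma rademacher_sqr j w : rademacher j w ^+ 2 = 1.
Proof. by rewrite /rademacher sqrr_sign. Qed.

Lemma bounded_rademacher j : bounded_fct (rademacher j).
Proof. by exists 1 => w; rewrite normr_sign. Qed.

Let ext n (t : {ffun 'I_n -> bool}) (i : nat) : bool :=
  if insub i is Some k then t k else false.

(** Functions of the signs whose mean is made to vanish: invariant under the global flip, and of
    average zero on the finite sign cubes from dimension [n] on. Orthogonality of the Rademacher
    functions is obtained in this form. *)
Definition balanced n (h : (nat -> bool) -> R) :=
  [/\ bounded_fct h, forall rho, h (fun i => ~~ rho i) = h rho &
      forall m, (n <= m)%N -> \sum_(t : {ffun 'I_m -> bool}) h (ext t) = 0].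

Lemma balanced0 n : balanced n (fun=> 0).
Proof. by split=> [||m _]//; [exact: bounded_fct_cst|rewrite big1]. Qed.

Lemma balancedD m n g h : balanced m g -> balanced n h ->
  balanced (maxn m n) (fun rho => g rho + h rho).
Proof.
move=> [bg gN g0] [bh hN h0]; split=> [|rho|k]; first exact: bounded_fctD.
  by rewrite gN hN.
by rewrite geq_max => /andP[mk nk]; rewrite big_split/= g0// h0// addr0.
Qed.

Lemma balancedZ n h (c : R) : balanced n h -> balanced n (fun rho => c * h rho).
Proof.
move=> [bh hN h0]; split=> [|rho|k nk]; first exact: bounded_fctZ.
  by rewrite hN.
by rewrite -mulr_sumr h0// mulr0.
Qed.

(** Flipping the [i]-th sign is an involution of the cube that negates the product. *)
Lemma balanced_rademacher i j : i != j ->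
  balanced (maxn i j).+1 (fun rho => (-1) ^+ rho i * (-1) ^+ rho j).
Proof.
move=> ij; split=> [|rho|m].
- by exists 1 => rho; rewrite normrM !normr_sign mulr1.
- by rewrite !signrN mulrNN.
rewrite gtn_max => /andP[im jm].
pose flip (t : {ffun 'I_m -> bool}) := [ffun k => t k (+) (k == Ordinal im)].
have flipK : involutive flip.
  by move=> t; apply/ffunP => k; rewrite !ffunE -addbA addbb addbF.
have extE t k (km : (k < m)%N) : ext t k = t (Ordinal km).
  by rewrite /ext insubT.
set s := LHS; suff : s = - s by lra.
rewrite {1}/s (reindex_inj (inv_inj flipK))/= -sumrN.
apply: eq_bigr => t _; rewrite !extE !ffunE eqxx.
have -> : (Ordinal jm == Ordinal im) = false by apply/negbTE; rewrite eq_sym.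
by rewrite addbF addbT signrN mulNr.
Qed.

(* Hahn-Banach applies because, for every choice of signs rho, the l1 lower
   estimate provides a point x at which the sum of the a_j rho_j y_j has modulus
   at least eta * sum a_j, and flipping rho makes it positive without changing
   a balanced function. *)
Lemma rademacher_mean (y : nat -> K -> R) (s eta : R) :
  0 < eta -> (forall j x, `|y j x| <= s) ->
  (forall n (a : nat -> R), exists x,
     eta * \sum_(j < n) `|a j| <= `|\sum_(j < n) a j * y j x|) ->
  exists2 L, is_mean L &
    (forall j, eta <= L (fun w => rademacher j w * y j w.1)) /\
    forall i j, i != j -> L (fun w => rademacher i w * rademacher j w) = 0.
Proof.
move=> eta0 ys low.
have by_ j : bounded_fct (fun w : K * (nat -> bool) => y j w.1) by exists s => w.
have bry j := bounded_fctM (bounded_rademacher j) (by_ j).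
pose F (a : nat -> R) m (w : K * (nat -> bool)) :=
  \sum_(j < m) a j * (rademacher j w * y j w.1 - eta).
(* The cone generated by the functions [r_j y_j - eta] and the balanced functions. Asking for the
   formula at every [m >= n] lets two members be compared at a common length. *)
pose U := [set f : K * (nat -> bool) -> R | exists n a h,
  [/\ forall j, 0 <= a j, balanced n h &
      forall m w, (n <= m)%N -> f w = F a m w + h w.2]].
have [|f g|t f t0|f|f c|L mL LU] := @exists_mean R _ U.
- exists 0%N, (fun=> 0), (fun=> 0); split=> //; first exact: balanced0.
  by move=> m w _; rewrite /F big1 ?addr0// => j _; rewrite mul0r.
- move=> [n [a [h [a0 bh fE]]]] [n' [a' [h' [a'0 bh' gE]]]].
  exists (maxn n n'), (fun j => a j + a' j), (fun rho => h rho + h' rho).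
  split=> [j||m w]; [exact: addr_ge0|exact: balancedD|].
  rewrite geq_max => /andP[nm n'm]; rewrite (fE m)// (gE m)// /F addrACA.
  by congr (_ + _); rewrite -big_split/=; apply: eq_bigr => j _; rewrite mulrDl.
- move=> [n [a [h [a0 bh fE]]]].
  exists n, (fun j => t * a j), (fun rho => t * h rho).
  split=> [j||m w nm]; [exact: mulr_ge0|exact: balancedZ|].
  rewrite (fE m)// mulrDr /F mulr_sumr; congr (_ + _).
  by apply: eq_bigr => j _; rewrite mulrA.
- move=> [n [a [h [_ [bh _ _] fE]]]].
  have -> : f = (fun w => F a n w + h w.2) by apply/funext => w; exact: fE.
  apply: bounded_fctD; last by have [B hB] := bh; exists B.
  apply: bounded_fct_sum => j; apply/bounded_fctZ/bounded_fctB => //.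
  exact: bounded_fct_cst.
- move=> [n [a [h [a0 [_ hN h0] fE]]]] c0 fc.
  have FE w : F a n w =
      \sum_(j < n) a j * (rademacher j w * y j w.1) - eta * \sum_(j < n) a j.
    rewrite mulr_sumr -sumrB; apply: eq_bigr => j _.
    by rewrite mulrBr (mulrC eta).
  have hc t : h (ext t) <= - c.
    have [x] := low n (fun j => a j * (-1) ^+ ext t j).
    have -> : \sum_(j < n) `|a j * (-1) ^+ ext t j| = \sum_(j < n) a j.
      by apply: eq_bigr => j _; rewrite normrM normr_sign mulr1 ger0_norm.
    set S := \sum_(j < n) _ * _ * _; have [S0|S0] := leP 0 S => le.
      rewrite ger0_norm// in le.
      have := fc (x, ext t); rewrite (fE n)// FE /=.
      rewrite (_ : \sum_(j < n) _ * _ = S); first by lra.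
      by apply: eq_bigr => j _; rewrite mulrA.
    rewrite ltr0_norm// in le.
    have := fc (x, fun i => ~~ ext t i); rewrite (fE n)// FE /= hN.
    rewrite (_ : \sum_(j < n) _ * _ = - S); first by lra.
    rewrite -sumrN; apply: eq_bigr => j _.
    by rewrite /rademacher signrN mulNr mulrN mulrA.
  (* The values of [h] on the cube sum to zero, yet each is at most [- c]. *)
  have := h0 n (leqnn _); apply/eqP; rewrite lt_eqF//.
  apply: (@le_lt_trans _ _ (\sum_(t : {ffun 'I_n -> bool}) - c)).
    exact: ler_sum.
  rewrite sumr_const pmulrn_llt0 ?oppr_lt0//.
  by apply/card_gt0P; exists [ffun=> false].
have Lbal n h : balanced n h -> 0 <= L (fun w => h w.2).
  move=> bh; apply: LU; exists n, (fun=> 0), h; split=> // m w _.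
  by rewrite /F big1 ?add0r// => j _; rewrite mul0r.
exists L => //; split=> [j|i j ij].
  have : 0 <= L (fun w => rademacher j w * y j w.1 - eta * 1).
    apply: LU; exists j.+1, (fun i => (i == j)%:R), (fun=> 0).
    split=> [i||m w jm]; [exact: ler0n|exact: balanced0|].
    rewrite addr0 /F (bigD1 (Ordinal jm))//= eqxx mul1r mulr1 big1 ?addr0//.
    by move=> i; rewrite -val_eqE/= => /negbTE ->; rewrite mul0r.
  rewrite meanB//; last exact/bounded_fctZ/bounded_fct_cst.
  rewrite (meanZ mL); last exact: bounded_fct_cst.
  by rewrite (mean1 mL) mulr1 subr_ge0.
have brr := bounded_fctM (bounded_rademacher i) (bounded_rademacher j).
apply/eqP; rewrite eq_le (Lbal _ _ (balanced_rademacher ij)) andbT.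
have := Lbal _ _ (balancedZ (-1) (balanced_rademacher ij)).
by rewrite (meanZ mL)// mulN1r oppr_ge0.
Qed.

End rademacher.

(** * Absence of l1-sequences over a relatively convergent class *)

Section no_ell1.
Variables (R : realType) (K : topologicalType).
Hypothesis cK : compact [set: K].
Implicit Type cs : seq (R * set K).

Definition comb cs (x : K) : R := \sum_(p <- cs) p.1 * \1_(p.2) x.

(* The indicators of the C i, i in M, converge pointwise. *)
Definition relatively_convergent (A : set (set K)) :=
  forall C : nat -> set K, (forall n, A (C n)) ->
  exists2 M, unbounded M & forall x, exists n, forall i j,
    M i -> M j -> (n <= i)%N -> (n <= j)%N -> C i x -> C j x.

Lemma comb_le cs x : `|comb cs x| <= \sum_(p <- cs) `|p.1|.
Proof.
apply: le_trans (ler_norm_sum _ _ _) _; apply: ler_sum => p _.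
rewrite normrM indicE normr_nat ler_piMr//.
by case: (_ \in _).
Qed.

Lemma unbounded_sqr_sum (c : nat -> R) (M : set nat) (theta : R) :
  0 < theta -> unbounded M -> (forall j, M j -> theta <= `|c j|) ->
  exists n, 1 < \sum_(j < n) c j ^+ 2.
Proof.
move=> theta0 uM Mc.
have step k : exists n, k%:R * theta ^+ 2 <= \sum_(j < n) c j ^+ 2.
  elim: k => [|k [n IH]]; first by exists 0%N; rewrite mul0r big_ord0.
  have [j Mj nj] := uM n; exists j.+1; rewrite big_ord_recr/= mulrSr mulrDl mul1r.
  apply: lerD; last first.
    rewrite -[leRHS]real_normK ?num_real// ler_pXn2r ?nnegrE ?(ltW theta0)//.
    exact: Mc.
  apply: le_trans IH _; rewrite -(subnKC nj) big_split_ord/= lerDl sumr_ge0//.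
  by move=> i _; exact: sqr_ge0.
pose k := (Num.truncn (theta ^+ 2)^-1).+1.
have [n kn] := step k; exists n; apply: lt_le_trans kn.
rewrite -ltr_pdivrMr ?exprn_gt0// mul1r; exact: truncnS_gt.
Qed.

Lemma relatively_convergent_no_ell1 (A : set (set K)) (cs : nat -> seq (R * set K))
    (s eta : R) :
  (forall C, A C -> clopen C) -> relatively_convergent A ->
  (forall j p, List.In p (cs j) -> A p.2) ->
  (forall j, \sum_(p <- cs j) `|p.1| <= s) -> 0 < eta ->
  ~ (forall n (a : nat -> R), exists x,
     eta * \sum_(j < n) `|a j| <= `|\sum_(j < n) a j * comb (cs j) x|).
Proof.
move=> Aclopen Aconv csA css eta0 low.
have s0 : 0 <= s by apply: le_trans (css 0%N); exact: sumr_ge0.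
have [j x|L mL [Ly Lrr]] :=
  @rademacher_mean R K (fun j => comb (cs j)) s eta eta0 _ low.
  exact: le_trans (comb_le _ _) (css j).
pose I (C : set K) (w : K * (nat -> bool)) : R := \1_C w.1.
have bI C : bounded_fct (I C).
  by exists 1 => w; rewrite /I indicE normr_nat; case: (_ \in _).
have br := @bounded_rademacher R K.
have bIr C j := bounded_fctM (bI C) (br j).
(* With [s + 1] in place of [s] the quotient makes sense for [s = 0], and [theta * s < eta] is
   strict. *)
pose theta := eta / (s + 1).
have s1 : 0 < s + 1 by rewrite ltr_wpDl.
have theta0 : 0 < theta by rewrite divr_gt0.
(* The combination [comb (cs j)] has total weight at most [s] and correlation at least [eta] with
   the [j]-th Rademacher function, so one of its sets has correlation at least [theta] in
   modulus. *)
have /choice[C CP] j : exists C,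
    A C /\ theta <= `|L (fun w => I C w * rademacher R j w)|.
  apply: contrapT => nC.
  have small p : List.In p (cs j) -> `|L (fun w => I p.2 w * rademacher R j w)| <= theta.
    by move=> pj; rewrite leNgt; apply/negP => /ltW le; apply: nC;
      exists p.2; split=> //; exact: csA pj.
  have := Ly j; rewrite leNgt; apply/negP; rewrite negbK.
  apply: (@le_lt_trans _ _ (theta * s)); last first.
    by rewrite /theta mulrAC ltr_pdivrMr// ltr_pM2l// ltrDl.
  apply: le_trans (ler_norm _) _.
  apply: le_trans (_ : theta * \sum_(p <- cs j) `|p.1| <= _); last first.
    by rewrite ler_wpM2l// ltW.
  rewrite (_ : L _ = \sum_(p <- cs j) p.1 * L (fun w => I p.2 w * rademacher R j w)).
    apply: le_trans (ler_norm_sum _ _ _) _; rewrite mulr_sumr.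
    elim: (cs j) small => [|p ps IH] small; first by rewrite !big_nil.
    rewrite !big_cons lerD// ?IH// => [|q qps]; last by apply: small; right.
    by rewrite normrM mulrC ler_wpM2r//; apply: small; left.
  rewrite (_ : L _ = L (fun w => \sum_(p <- cs j) p.1 * (I p.2 w * rademacher R j w))).
    rewrite mean_sum// => [|p]; last exact/bounded_fctZ/bIr.
    by apply: eq_bigr => p _; rewrite (meanZ mL).
  congr L; apply/funext => w; rewrite /comb mulr_sumr; apply: eq_bigr => p _.
  by rewrite mulrCA; congr (_ * _); rewrite mulrC.
have [M uM Mcv] := Aconv C (fun n => (CP n).1).
pose mu (B : set K) := L (I B).
pose sd (B E : set K) := (B `\` E) `|` (E `\` B).
have mu_le B E : B `<=` E -> mu B <= mu E.
  move=> BE; apply: (le_mean mL) => // w; rewrite /I !indicE ler_nat.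
  by case: (boolP (w.1 \in B)) => // /set_mem/BE/mem_set ->.
(* Pointwise convergence gives the Cauchy property in mean: otherwise some point would lie in
   symmetric differences of arbitrarily late pairs of sets, by [finitely_additive_limsup]. *)
have cauchy : exists2 j0, M j0 & forall j, M j -> (j0 <= j)%N ->
    mu (sd (C j) (C j0)) <= theta / 2.
  apply: contrapT => nc.
  have /choice[jk jkP] i : exists jk : nat * nat,
      [/\ M jk.1, M jk.2, (i <= jk.1)%N, (i <= jk.2)%N &
          theta / 2 <= mu (sd (C jk.2) (C jk.1))].
    apply: contrapT => njk; have [j Mj ij] := uM i; apply: nc.
    exists j => // k Mk jk; rewrite leNgt; apply/negP => lt.
    by apply: njk; exists (j, k); split=> //; [exact: leq_trans jk|exact: ltW].
  have [|||||||x xio] := @finitely_additive_limsup R K cK mu 1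
      (fun i => sd (C (jk i).2) (C (jk i).1)) (theta / 2).
  - exact: mu_le.
  - move=> B E BE0; rewrite /mu -(meanD mL)//; congr L; apply/funext => w.
    rewrite /I !indicE in_setU; case: (boolP (w.1 \in B)) => [wB|_] /=;
      last by rewrite add0r.
    rewrite (_ : (w.1 \in E) = false) ?addr0//; apply/negbTE/negP => /set_mem wE.
    have : (B `&` E) w.1 by split=> //; exact: set_mem.
    by rewrite BE0.
  - by rewrite -(mean0 mL); congr L; apply/funext => w; rewrite /I indic0.
  - move=> B; rewrite -(mean1 mL); apply: (le_mean mL) => //.
      exact: bounded_fct_cst.
    by move=> w; rewrite /I indicE; case: (_ \in _).
  - move=> n; have [oj cj] := Aclopen _ (CP (jk n).1).1.
    have [ok ck] := Aclopen _ (CP (jk n).2).1.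
    by apply: closedU; rewrite setDE; apply: closedI => //; exact: open_closedC.
  - by rewrite divr_gt0.
  - by move=> n; have [] := jkP n.
  have [n nP] := Mcv x; have [i ni] := xio n.
  have [Mj Mk ij ik _] := jkP i.
  have nj := leq_trans ni ij; have nk := leq_trans ni ik.
  by case=> -[Ci]; apply; exact: nP Ci.
have [j0 Mj0 j0P] := cauchy; pose f := I (C j0).
pose M' := M `&` [set j | (j0 <= j)%N].
have uM' : unbounded M'.
  move=> n; have [m Mm] := uM (maxn n j0); rewrite geq_max => /andP[nm jm].
  by exists m.
have th2 : 0 < theta / 2 by rewrite divr_gt0.
have [|n] := @unbounded_sqr_sum
  (fun j => L (fun w => f w * rademacher R j w)) M' _ th2 uM'.
  move=> j [Mj /= jj0].
  (* Replacing [C j] by [C j0] changes the correlation by at most the measure of their symmetric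
     difference. *)
  have le : `|L (fun w => (I (C j) w - f w) * rademacher R j w)| <= theta / 2.
    apply: le_trans (j0P j Mj jj0); apply: (mean_norm_le mL) => // [|w].
      exact: (bounded_fctM (bounded_fctB (bI (C j)) (bI (C j0))) (br j)).
    rewrite normrM normr_sign mulr1 /f /I /sd !indicE.
    have [wj|wj] := boolP (w.1 \in C j); have [w0|w0] := boolP (w.1 \in C j0).
    - by rewrite subrr normr0.
    - rewrite subr0 normr1 mem_set//; left; split; first exact: set_mem.
      by move=> /mem_set; rewrite (negbTE w0).
    - rewrite sub0r normrN normr1 mem_set//; right; split; first exact: set_mem.
      by move=> /mem_set; rewrite (negbTE wj).
    - by rewrite subrr normr0.
  have [_ ge] := CP j.
  have E : L (fun w => (I (C j) w - f w) * rademacher R j w) =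
      L (fun w => I (C j) w * rademacher R j w) - L (fun w => f w * rademacher R j w).
    rewrite -(meanB mL (bIr (C j) j) (bIr (C j0) j)).
    by congr L; apply/funext => w; rewrite mulrBl.
  rewrite E in le; move: ge le.
  set u := L (fun w => I (C j) w * _); set v := L _ => ge le.
  by have := ler_normD (u - v) v; rewrite subrK; lra.
(* Bessel bounds the squared correlations of [C j0] by the mean of its indicator, hence by 1. *)
have := mean_bessel mL n br (@rademacher_sqr R K) Lrr (bI (C j0)).
move=> le1; rewrite ltNge => /negP; apply; apply: le_trans le1 _.
rewrite -(mean1 mL); apply: (le_mean mL); [|exact: bounded_fct_cst|].
  by under eq_fun do rewrite expr2; exact: bounded_fctM.
by move=> w; rewrite /I indicE; case: (_ \in _); rewrite ?expr1n ?expr0n.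
Qed.

End no_ell1.

(** * Continuity in the topology of pointwise convergence *)

Lemma ptws_eval_continuous (U : Type) (V : topologicalType) (u : U) :
  continuous (fun g : {ptws U -> V} => g u).
Proof.
move=> g; have /cvg_sup/(_ u) gu : g --> g by exact: cvg_id.
move=> A gA; apply: gu.
exact: (@initial_continuous _ _ (fun g : U -> V => g u) g A gA).
Qed.

Lemma continuous_ptws (T : topologicalType) (U : Type) (V : topologicalType)
    (h : T -> {ptws U -> V}) :
  (forall u, continuous (fun t => h t u)) -> continuous h.
Proof.
move=> hc t; apply/cvg_sup => u A.
move=> /= [B [[C oC <-] /= Chu] BA].
have : nbhs t ((fun t => h t u) @^-1` C).
  by apply: hc; exact: open_nbhs_nbhs.
by apply: filterS => s /= Cs; exact: BA.
Qed.

(** * Clopen sets and finitely many coordinates of the cube *)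

Section coordinate_classes.
Variables (R : realType) (K : topologicalType) (Gamma : Type).
Variable f : Gamma -> K -> R.
Hypothesis cK : compact [set: K].
Hypothesis f01 : forall alpha x, 0 <= f alpha x <= 1.
Hypothesis fcont : forall alpha, continuous (f alpha).
Hypothesis fsep : forall x y, (forall alpha, f alpha x = f alpha y) -> x = y.

Lemma invSn_gt0 m : 0 < m.+1%:R^-1 :> R.
Proof. by rewrite invr_gt0 ltr0n. Qed.

(** Otherwise compactness of the product of [C] and its complement yields a pair of points that
    agree in all coordinates. The factor 3 matches the oscillation bound in
    [coordinate_sequence_types]. *)
Lemma clopen_finite_coordinates (C : set K) : clopen C ->
  exists m (s : seq Gamma), forall x y, C x -> ~ C y ->
    exists2 alpha, List.In alpha s & 3 * m.+1%:R^-1 < `|f alpha x - f alpha y|.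
Proof.
move=> [oC cC].
have cpt : compact (C `*` ~` C).
  apply: compact_setX; apply: (subclosed_compact _ cK) => //.
  exact: open_closedC.
apply: contrapT => nC.
pose B (ms : nat * seq Gamma) := [set xy | (C `*` ~` C) xy /\
  forall alpha, List.In alpha ms.2 ->
    `|f alpha xy.1 - f alpha xy.2| <= 3 * ms.1.+1%:R^-1].
have BF : ProperFilter (filter_from [set: nat * seq Gamma] B).
  apply: filter_from_proper => [|[m s] _]; last first.
    apply: contrapT => nB; apply: nC; exists m, s => x y Cx nCy.
    apply: contrapT => nalpha; apply: nB; exists (x, y); split => // alpha sa.
    by rewrite leNgt; apply/negP => lt; apply: nalpha; exists alpha.
  apply: filter_from_filter; first by exists (0%N, [::]).
  move=> [m s] [n t] _ _; exists (maxn m n, s ++ t) => // -[x y] [Cxy Bxy].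
  have le k : (k <= maxn m n)%N ->
      3 * (maxn m n).+1%:R^-1 <= 3 * k.+1%:R^-1 :> R.
    by move=> kmn; rewrite ler_pM2l// lef_pV2 ?posrE ?ltr0n// ler_nat ltnS.
  split; split => // alpha sa.
    apply: le_trans (Bxy _ _) (le _ (leq_maxl _ _)).
    by apply/List.in_or_app; left.
  apply: le_trans (Bxy _ _) (le _ (leq_maxr _ _)).
  by apply/List.in_or_app; right.
have [|[x y] [[/= Cx nCy] cl]] := cpt _ BF.
  by exists (0%N, [::]) => // xy [].
suff xy : x = y by apply: nCy; rewrite -xy.
apply: fsep => alpha; apply/eqP; rewrite -subr_eq0 -normr_le0.
apply/ler_addgt0Pl => e e0; rewrite addr0.
have [m me] : exists m, 3 * m.+1%:R^-1 <= e.
  exists (Num.truncn (3 / e)).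
  rewrite ler_pdivrMr ?ltr0n// mulrC -ler_pdivrMr//.
  by apply/ltW; exact: truncnS_gt.
apply: le_trans me.
pose g (xy : K * K) := `|f alpha xy.1 - f alpha xy.2|.
have cg : continuous g.
  move=> xy; apply: cvg_norm; apply: cvgB.
    apply: continuous_comp; [exact: cvg_fst|exact: fcont].
  apply: continuous_comp; [exact: cvg_snd|exact: fcont].
pose F := g @^-1` [set z | z <= 3 * m.+1%:R^-1].
have cF : closed F.
  by apply: preimage_closed => // z _; exact: cg.
suff : F (x, y) by [].
apply: cF => N xyN; apply: cl => //; exists (m, [:: alpha]) => //.
by move=> z [_ Bz]; apply: Bz; left.
Qed.

Variable G : nat -> nat -> set Gamma.
Hypothesis GT : forall m alpha, exists n, G m n alpha.
Hypothesis Gindep : forall m n p q, p < q -> m.+1%:R^-1 < q - p ->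
  ~ contains_independent_sequence (G m n)
    (fun alpha (i : bool) =>
       if i then [set x | q < f alpha x] else [set x | f alpha x < p]).

(** The dichotomy is applied at the finitely many levels of a grid of mesh [eps]. Along the
    resulting subsequence the values at each point end up in a window of three grid steps, and the
    window is the type of the point. *)
Lemma coordinate_sequence_types m n (a : nat -> Gamma) (M : set nat) :
  (forall k, G m n (a k)) -> unbounded M ->
  exists M' (T : finType) (tau : K -> T), [/\ unbounded M', M' `<=` M &
    forall x y, tau x = tau y -> exists k0, forall k, M' k -> (k0 <= k)%N ->
      `|f (a k) x - f (a k) y| <= 3 * m.+1%:R^-1].
Proof.
move=> Ga uM; set eps := m.+1%:R^-1; have eps0 : 0 < eps by exact: invSn_gt0.
(* The levels lie two steps apart because their gap must exceed [eps] strictly. *)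
pose A (u : nat) (k : nat) (i : bool) :=
  if i then [set x | u.+2%:R * eps < f (a k) x] else [set x | f (a k) x < u%:R * eps].
have ref u N : unbounded N -> exists N', [/\ unbounded N', N' `<=` N &
    forall x, pairs_converge_at (A u) N' x].
  move=> uN; have [//|[b _ bP]] := rosenthal_dichotomy (A u) uN.
  exfalso; apply: (@Gindep m n (u%:R * eps) (u.+2%:R * eps)).
  - by rewrite ltr_pM2r// ltr_nat ltnW.
  - rewrite -/eps -mulrBl -natrB; last exact: ltnW.
    by rewrite -addn2 addKn ltr_pMl// ltr1n.
  - exists (a \o b); first by move=> k; exact: Ga.
    split=> // k; apply/seteqP; split=> // x [/= lt gt].
    have : u%:R * eps <= u.+2%:R * eps by rewrite ler_pM2r// ler_nat ltnW.
    by move: lt gt; lra.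
have [|M' [uM' sM' cv]] := finite_refinement (iota 0 m.+3) _ ref uM.
  move=> u N N' cN N'N x.
  by apply: (pairs_converge_at_almost_sub (n := 0%N)) (cN x) => k /N'N.
have /choice[tau tauP] x : exists u : 'I_m.+2, exists k0, forall k,
    M' k -> (k0 <= k)%N -> u%:R * eps <= f (a k) x <= u.+3%:R * eps.
  apply: contrapT => nu.
  (* If no window caught [x], the values would climb level by level above [m.+2%:R * eps], which
     exceeds 1. *)
  have [k0 k0P] : exists k0, forall k, M' k -> (k0 <= k)%N -> m.+2%:R * eps <= f (a k) x.
    elim: {-2}m.+2 (leqnn m.+2) => [_|u IH um].
      by exists 0%N => k _ _; rewrite mul0r; have /andP[] := f01 (a k) x.
    have [k0 k0P] := IH (ltnW um).
    have [] := cv u.+1 _ x; first by rewrite mem_iota.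
    case=> -[k1 /= k1P]; last first.
      by exists k1 => k Mk kk; rewrite leNgt; apply/negP; exact: k1P.
    exfalso; apply: nu; exists (Ordinal um), (maxn k0 k1) => k Mk /=.
    rewrite geq_max => /andP[kk0 kk1]; rewrite k0P//= leNgt.
    by apply/negP; exact: k1P.
  have [k Mk kk] := uM' k0; have := k0P k Mk kk; apply/negP; rewrite -ltNge.
  have /andP[_ /le_lt_trans] := f01 (a k) x; apply.
  by rewrite ltr_pdivlMr ?ltr0n// mul1r ltr_nat.
exists M', 'I_m.+2, tau; split=> // x y xy.
have [k0 k0P] := tauP x; have [k1 k1P] := tauP y.
exists (maxn k0 k1) => k Mk; rewrite geq_max => /andP[kk0 kk1].
have /andP[x1 x2] := k0P k Mk kk0; have := k1P k Mk kk1; rewrite -xy => /andP[y1 y2].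
have e3 : (tau x).+3%:R * eps = (tau x)%:R * eps + 3 * eps.
  by rewrite -addn3 natrD mulrDl.
by rewrite ler_norml; apply/andP; move: x1 x2 y1 y2; rewrite e3; lra.
Qed.

Lemma coordinate_list_types m ns (s : nat -> seq Gamma) (M : set nat) :
  (forall k, List.Forall2 (fun alpha n => G m n alpha) (s k) ns) -> unbounded M ->
  exists M' (T : finType) (tau : K -> T), [/\ unbounded M', M' `<=` M &
    forall x y, tau x = tau y -> exists k0, forall k, M' k -> (k0 <= k)%N ->
      forall alpha, List.In alpha (s k) ->
      `|f alpha x - f alpha y| <= 3 * m.+1%:R^-1].
Proof.
elim: ns s M => [|n ns IH] s M sP uM.
  exists M, unit, (fun=> tt); split=> // x y _; exists 0%N => k _ _.
  by have := sP k; move: (s k) => t tP; inversion tP.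
have /choice[a /choice[s' as'P]] k : exists alpha t,
    [/\ s k = alpha :: t, G m n alpha &
        List.Forall2 (fun alpha n => G m n alpha) t ns].
  have := sP k; move: (s k) => t tP; inversion tP as [|alpha n' t' ns' h1 h2].
  by exists alpha, t'.
have [k||M1 [T1 [tau1 [uM1 sM1 tau1P]]]] := @coordinate_sequence_types m n a M.
- by have [] := as'P k.
- exact: uM.
have [k|M2 [T2 [tau2 [uM2 sM2 tau2P]]]] := IH s' M1 _ uM1.
  by have [] := as'P k.
exists M2, (T1 * T2)%type, (fun x => (tau1 x, tau2 x)); split=> //.
  exact: subset_trans sM1.
move=> x y [e1 e2]; have [k1 k1P] := tau1P x y e1.
have [k2 k2P] := tau2P x y e2; exists (maxn k1 k2) => k Mk.
rewrite geq_max => /andP[kk1 kk2] alpha; have [-> _ _] := as'P k.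
by move=> [<-|]; [apply: k1P => //; exact: sM2|exact: k2P].
Qed.

(** The index records a margin and, for each separating coordinate, a piece containing it, but not
    the coordinate itself; so there are countably many classes. *)
Definition coordinate_class (c : nat * seq nat) : set (set K) :=
  [set C | clopen C /\ exists s,
    List.Forall2 (fun alpha n => G c.1 n alpha) s c.2 /\
    forall x y, C x -> ~ C y -> exists2 alpha, List.In alpha s &
      3 * c.1.+1%:R^-1 < `|f alpha x - f alpha y|].

Lemma coordinate_class_cover C : clopen C -> exists c, coordinate_class c C.
Proof.
move=> Cclopen; have [m [s sP]] := clopen_finite_coordinates Cclopen.
have [n nP] := choice (GT m).
exists (m, map n s); split=> //; exists s; split=> //=.
by elim: s {sP} => [|alpha s IH] /=; constructor.
Qed.

(** Points of the same type eventually belong to the same sets [C k], as the separating coordinates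
    differ too little between them. It remains to settle one point for each of the finitely many
    types, by the pigeonhole principle. *)
Lemma relatively_convergent_coordinate_class c :
  relatively_convergent (coordinate_class c).
Proof.
move=> C Cc; have /choice[s sP] k := (Cc k).2.
have [M1 [T [tau [uM1 _ tauP]]]] :=
  @coordinate_list_types c.1 c.2 s _ (fun k => (sP k).1) unbounded_nat.
have sepP k x y : C k x -> (forall alpha, List.In alpha (s k) ->
    `|f alpha x - f alpha y| <= 3 * c.1.+1%:R^-1) -> C k y.
  move=> Ckx le; apply: contrapT => nCky.
  have [alpha /le] := (sP k).2 _ _ Ckx nCky.
  by rewrite leNgt => /negP.
pose P t (M : set nat) := (exists x0, tau x0 = t) ->
  exists x0, tau x0 = t /\ exists b : bool, forall k, M k -> C k x0 <-> b.
have ref t M : unbounded M -> exists M', [/\ unbounded M', M' `<=` M & P t M'].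
  move=> uM; have [[x0 x0t]|nt] := pselect (exists x0, tau x0 = t); last first.
    by exists M; split.
  have [b ub] := unbounded_pigeonhole (fun k => `[< C k x0 >]) uM.
  exists (M `&` [set k | `[< C k x0 >] = b]); split=> // _.
  exists x0; split=> //; exists b => k [_ /= <-].
  by split=> /asboolP.
have [|M2 [uM2 sM2 M2P]] := finite_refinement (enum T) _ ref uM1.
  move=> t M M' PM M'M /PM[x0 [x0t [b bP]]]; exists x0; split=> //.
  by exists b => k /M'M; exact: bP.
exists M2 => // x.
have [|x0 [x0x [b bP]]] := M2P (tau x) _ (ex_intro _ x erefl).
  by rewrite mem_enum.
have [n0 n0P] := tauP _ _ x0x; exists n0 => i j Mi Mj ni nj Cix.
have := n0P i (sM2 _ Mi) ni => Hi; have := n0P j (sM2 _ Mj) nj => Hj.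
apply: (sepP _ _ _ _ Hj); apply/(bP j Mj); apply/(bP i Mi).
by apply: (sepP _ _ _ Cix) => alpha sa; rewrite distrC; exact: Hi.
Qed.

End coordinate_classes.

(** * An increasing sequence of relatively convergent classes *)

Lemma relatively_convergent_finite_union (K : topologicalType) (I : finType)
    (A : I -> set (set K)) :
  (forall i, relatively_convergent (A i)) ->
  relatively_convergent [set C | exists i, A i C].
Proof.
move=> Aconv C /choice[c cP].
have [i ui] := unbounded_pigeonhole c unbounded_nat.
have /choice[g gP] n : exists k, c k = i /\ (n <= k)%N.
  by have [k [_ ck] nk] := ui n; exists k.
have [k|M uM Mcv] := Aconv i (C \o g); first by rewrite -(gP k).1; exact: cP.
exists (g @` M).
  by move=> n; have [k Mk nk] := uM n; exists (g k); [exists k|exact: leq_trans (gP k).2].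
(* [g] need not be increasing, but a value above [g k] for all [k < n] comes from an index at least
   [n]. *)
move=> x; have [n nP] := Mcv x; exists (\max_(k < n) g k).+1.
have large k : ((\max_(k < n) g k).+1 <= g k)%N -> (n <= k)%N.
  move=> lt; rewrite leqNgt; apply/negP => kn; move: lt; apply/negP.
  by rewrite -leqNgt (leq_bigmax (Ordinal kn)).
by move=> _ _ [k Mk <-] [l Ml <-] /large nk /large nl; exact: nP.
Qed.

Lemma QWRN_clopen_filtration (R : realType) (K : topologicalType) :
  compact [set: K] -> QWRN R K ->
  exists W : nat -> set (set K), [/\ forall n, W n `<=` W n.+1,
    forall n, W n `<=` @clopen K, forall n, relatively_convergent (W n) &
    forall C, clopen C -> exists n, W n C].
Proof.
move=> cK [Gamma [e [[einj econt _] eG]]].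
have /choice[G GP] m : exists G : nat -> set Gamma,
    [set: Gamma] = \bigcup_n G n /\
    forall p q : R, p < q -> m.+1%:R^-1 < q - p ->
    forall n, ~ contains_independent_sequence (G n)
      (fun alpha (i : bool) =>
         if i then [set x : K | q < val (e x alpha)]
         else [set x : K | val (e x alpha) < p]).
  by have [G GT Gi] := eG _ (@invSn_gt0 R m); exists G.
pose f alpha x : R := val (e x alpha).
have f01 alpha x : 0 <= f alpha x <= 1.
  by have := valP (e x alpha); rewrite inE /= in_itv.
have fcont alpha : continuous (f alpha).
  move=> x; apply: (@continuous_comp _ _ _ (fun x => e x alpha) val).
    apply: (@continuous_comp _ _ _ e (fun z => z alpha)); first exact: econt.
    exact: ptws_eval_continuous.
  exact: initial_continuous.
have fsep x y : (forall alpha, f alpha x = f alpha y) -> x = y.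
  by move=> xy; apply: einj; apply/funext => alpha; apply: val_inj; exact: xy.
have GT m alpha : exists n, G m n alpha.
  have : [set: Gamma] alpha by [].
  by rewrite (GP m).1 => -[n _ Gn]; exists n.
pose cl := coordinate_class f G.
(* The union of the classes with code at most [n]; each code belongs to at most one class. *)
pose W n := [set C | exists i : 'I_n.+1, exists c, pickle c = i /\ cl c C].
exists W; split.
- by move=> n C [i ic]; exists (widen_ord (leqnSn _) i).
- by move=> n C [i [c [_ []]]].
- move=> n; apply: (@relatively_convergent_finite_union _ _
    (fun i : 'I_n.+1 => [set C | exists c, pickle c = i /\ cl c C])) => i C Ci.
  have [c [ci _]] := Ci 0%N.
  apply: (relatively_convergent_coordinate_class f01 (G := G) _ (c := c)).
    by move=> m k p q pq mpq; exact: (GP m).2.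
  move=> k; have [c' [c'i]] := Ci k.
  by rewrite (pcan_inj pickleK (etrans c'i (esym ci))).
- move=> C /(coordinate_class_cover cK fcont fsep GT)[c cC].
  by exists (pickle c), ord_max, c.
Qed.

(** * The interpolation space *)

Section gauge.
Variables (R : realType) (K : topologicalType) (W : nat -> set (set K)).
Implicit Types (x y : K -> R) (cs : seq (R * set K)).

Lemma comb_cat cs cs' t : comb (cs ++ cs') t = comb cs t + comb cs' t.
Proof. by rewrite /comb big_cat. Qed.

Lemma comb_scale (c : R) cs t :
  comb [seq (c * p.1, p.2) | p <- cs] t = c * comb cs t.
Proof.
by rewrite /comb big_map mulr_sumr; apply: eq_bigr => p _; rewrite mulrA.
Qed.

(* x lies in r times the sum of 2^n times the absolutely convex hull of the
   indicators of W n and of the ball of radius 2^-n for the sup norm. *)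
Definition gauge_le n (r : R) x := exists cs,
  [/\ forall p, List.In p cs -> W n p.2, \sum_(p <- cs) `|p.1| <= r * 2 ^+ n &
      forall t, `|x t - comb cs t| <= r / 2 ^+ n].

Let pow2_gt0 n : 0 < 2 ^+ n :> R.
Proof. by rewrite exprn_gt0. Qed.

Lemma gauge_le_ge0 n r x : gauge_le n r x -> 0 <= r.
Proof.
move=> [cs [_ le _]]; rewrite -(pmulr_lge0 _ (pow2_gt0 n)).
by apply: le_trans le; exact: sumr_ge0.
Qed.

Lemma le_gauge_le n r r' x : r <= r' -> gauge_le n r x -> gauge_le n r' x.
Proof.
move=> rr' [cs [Wcs le app]]; exists cs; split=> // [|t].
  by apply: le_trans le _; rewrite ler_pM2r.
by apply: le_trans (app t) _; rewrite ler_pM2r// invr_gt0.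
Qed.

Lemma gauge_le_small n r x :
  (forall t, `|x t| <= r / 2 ^+ n) -> 0 <= r -> gauge_le n r x.
Proof.
move=> xr r0; exists [::]; split=> // [|t].
  by rewrite big_nil mulr_ge0// ltW.
by rewrite /comb big_nil subr0.
Qed.

Lemma gauge_leD n r r' x y : gauge_le n r x -> gauge_le n r' y ->
  gauge_le n (r + r') (fun t => x t + y t).
Proof.
move=> [cs [Wcs le app]] [cs' [Wcs' le' app']]; exists (cs ++ cs'); split.
- by move=> p pcs; have [|] := List.in_app_or _ _ _ pcs; [exact: Wcs|exact: Wcs'].
- by rewrite big_cat/= mulrDl lerD.
- move=> t; rewrite comb_cat opprD addrACA mulrDl.
  by apply: le_trans (ler_normD _ _) _; exact: lerD.
Qed.

Lemma gauge_leZ n r c x :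
  gauge_le n r x -> gauge_le n (`|c| * r) (fun t => c * x t).
Proof.
move=> [cs [Wcs le app]]; exists [seq (c * p.1, p.2) | p <- cs]; split.
- move=> p pcs; have [q [<- qcs]] := proj1 (List.in_map_iff _ _ _) pcs.
  exact: (Wcs q).
- rewrite big_map -mulrA; under eq_bigr do rewrite normrM.
  by rewrite -mulr_sumr ler_wpM2l.
- by move=> t; rewrite comb_scale -mulrBr normrM -mulrA ler_wpM2l.
Qed.

Lemma gauge_le_bounded n r x t : gauge_le n r x -> `|x t| <= r * (2 ^+ n + (2 ^+ n)^-1).
Proof.
move=> [cs [_ le app]]; rewrite -(subrK (comb cs t) (x t)) mulrDr addrC.
apply: le_trans (ler_normD _ _) _; apply: lerD => //.
exact: le_trans (comb_le _ _) le.
Qed.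

(** The interpolation space in its c0 form: the gauges must tend to 0, instead of being
    square-summable. The gliding hump relies on this. *)
Definition interp_pred : {pred K -> R^o} := fun x =>
  `[< forall e : R, 0 < e -> exists N, forall n, (N <= n)%N -> gauge_le n e x >].

Lemma interp_pred_gauge x : x \in interp_pred -> exists r, forall n, gauge_le n r x.
Proof.
move=> /asboolP/(_ 1 ltr01)[N NP].
pose B := 1 * (2 ^+ N + (2 ^+ N)^-1) : R.
have xB t : `|x t| <= B by apply: gauge_le_bounded; exact: NP.
have B0 : 0 <= B by rewrite /B mul1r addr_ge0 ?invr_ge0 ?ltW.
(* From [N] on the bound 1 is enough; for [n < N] the ball of radius [2^-n] alone absorbs [x] at
   cost [2 ^+ N * B]. *)
exists (1 + 2 ^+ N * B) => n; have p0 : 0 <= 2 ^+ N * B by rewrite mulr_ge0// ltW.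
have [Nn|nN] := leqP N n.
  by apply: le_gauge_le (NP n Nn); rewrite lerDl.
apply: (@le_gauge_le _ (2 ^+ N * B)); first by rewrite lerDr.
apply: gauge_le_small => // t; apply: (le_trans (xB t)).
rewrite ler_pdivlMr// [leLHS]mulrC; apply: ler_wpM2r => //.
by apply: ler_weXn2l; [rewrite ler1n|exact: ltnW].
Qed.

Lemma interp_submod_closed : submod_closed interp_pred.
Proof.
split=> [|c x y /asboolP Xx /asboolP Xy]; apply/asboolP => e e0.
  exists 0%N => n _; apply: gauge_le_small; last exact: ltW.
  by move=> t; rewrite normr0 divr_ge0// ltW.
have c1 : 0 < `|c| + 1 by rewrite ltr_wpDl.
have e20 : 0 < e / 2 by rewrite divr_gt0.
have [N NP] := Xx (e / 2 / (`|c| + 1)) (divr_gt0 e20 c1).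
have [N' NP'] := Xy _ e20.
exists (maxn N N') => n; rewrite geq_max => /andP[Nn N'n].
apply: (@le_gauge_le _ (`|c| * (e / 2 / (`|c| + 1)) + e / 2)).
  rewrite [leRHS](splitr e) lerD2r mulrCA ger_pMr//.
  by rewrite ler_pdivrMr// mul1r lerDl.
by apply: gauge_leD; [apply: gauge_leZ; exact: NP|exact: NP'].
Qed.

HB.instance Definition _ := GRing.isSubmodClosed.Build R (K -> R^o) interp_pred
  interp_submod_closed.

Record interp := Interp {
  interp_val : K -> R^o;
  interp_valP : interp_val \in interp_pred }.

HB.instance Definition _ := [isSub for interp_val].
HB.instance Definition _ := [Choice of interp by <:].
HB.instance Definition _ := [SubChoice_isSubLmodule of interp by <:].

(** Equals the supremum over [n] of the gauges of [x]. *)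
Definition interp_norm (x : interp) : R :=
  inf [set r | forall n, gauge_le n r (val x)].

Lemma interp_norm_le (x : interp) r :
  (forall n, gauge_le n r (val x)) -> interp_norm x <= r.
Proof.
move=> xr; apply: ge_inf => //; exists 0 => s /(_ 0%N); exact: gauge_le_ge0.
Qed.

Lemma interp_norm_lt (x : interp) r n : interp_norm x < r -> gauge_le n r (val x).
Proof.
move=> /inf_lt; case; first exact: (interp_pred_gauge (valP x)).
by move=> s /(_ n) xs sr; exact: le_gauge_le (ltW sr) xs.
Qed.

Lemma interp_norm_ge0 (x : interp) : 0 <= interp_norm x.
Proof.
apply: lb_le_inf; first exact: (interp_pred_gauge (valP x)).
by move=> s /(_ 0%N); exact: gauge_le_ge0.
Qed.

(** The constant is [2 ^+ 0 + (2 ^+ 0)^-1], from the gauge of index 0. *)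
Lemma interp_sup_le (x : interp) t : `|val x t| <= 2 * interp_norm x.
Proof.
rewrite -ler_pdivrMl//; apply/ler_addgt0Pr => e e0; rewrite ler_pdivrMl//.
have /(@interp_norm_lt x _ 0%N)/(gauge_le_bounded t) :
    interp_norm x < interp_norm x + e by rewrite ltrDl.
by rewrite expr0 invr1 mulrC.
Qed.

Lemma interp_normD (x y : interp) :
  interp_norm (x + y) <= interp_norm x + interp_norm y.
Proof.
apply/ler_addgt0Pr => e e0; apply: interp_norm_le => n.
have e20 : 0 < e / 2 by rewrite divr_gt0.
rewrite {1}(splitr e) addrACA.
by apply: gauge_leD; apply: interp_norm_lt; rewrite ltrDl.
Qed.

Let interp_normZ_le (l : R) (x : interp) : interp_norm (l *: x) <= `|l| * interp_norm x.
Proof.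
apply: le_mul_inf => //; first exact: (interp_pred_gauge (valP x)).
by move=> r xr; apply: interp_norm_le => n; exact: (gauge_leZ l (xr n)).
Qed.

Lemma interp_normZ (l : R) (x : interp) : interp_norm (l *: x) = `|l| * interp_norm x.
Proof.
apply/eqP; rewrite eq_le interp_normZ_le/=; have [->|l0] := eqVneq l 0.
  by rewrite normr0 mul0r; exact: interp_norm_ge0.
rewrite -{1}(scale1r x) -(mulVf l0) -scalerA.
rewrite -ler_pdivlMl ?normr_gt0// -normfV; exact: interp_normZ_le.
Qed.

Lemma interp_norm0_eq0 (x : interp) : interp_norm x = 0 -> x = 0.
Proof.
move=> x0; apply/val_inj/funext => t; apply/eqP.
by have := interp_sup_le x t; rewrite x0 mulr0 normr_le0.
Qed.

HB.instance Definition _ := Lmodule_isNormed.Build R interp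
  interp_normD interp_normZ interp_norm0_eq0.

Lemma interp_valB (x y : interp) t : val (x - y) t = val x t - val y t :> R.
Proof. by []. Qed.

Lemma interp_normE (x : interp) : `|x| = interp_norm x. Proof. by []. Qed.

Lemma interp_complete (F : set_system interp) : ProperFilter F -> cauchy F -> cvg F.
Proof.
move=> PF /cauchyP Fc.
have /choice[c cP] (e : R) : exists x : interp, 0 < e -> F (ball x e).
  by have [e0|e0] := ltP 0 e; [have [x] := Fc _ e0; exists x|exists 0].
have ballE (x y : interp) e : ball x e y -> `|x - y| < e.
  by rewrite -ball_normE.
have near t e : 0 < e ->
    F [set y : interp | `|interp_val (c e) t - interp_val y t| <= 2 * e].
  move=> e0; apply: filterS (cP e e0) => y /ballE cy.
  apply: le_trans (interp_sup_le (c e - y) t) _.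
  by rewrite ler_pM2l// ltW.
pose ev t (x : interp) : R := interp_val x t.
have cvt t : cvg (ev t @ F).
  apply: cauchy_cvg; apply/cauchyP => e e0.
  exists (ev t (c (e / 3))); have e30 : 0 < e / 3 by rewrite divr_gt0.
  suff : F [set y | ball (ev t (c (e / 3))) e (ev t y)] by [].
  apply: filterS (near t _ e30) => y le; rewrite /mkset -ball_normE /ball_ /mkset.
  by apply: le_lt_trans le _; lra.
pose z t := lim (ev t @ F).
have zP e t : 0 < e -> `|interp_val (c e) t - z t| <= 2 * e.
  move=> e0.
  have cl : closed [set u : R | `|ev t (c e) - u| <= 2 * e].
    rewrite (_ : mkset _ = (fun u => `|ev t (c e) - u|) @^-1` [set u | u <= 2 * e])//.
    apply: preimage_closed; last exact: closed_le.
    move=> u _; apply: cvg_norm; apply: cvgB; [exact: cvg_cst|exact: cvg_id].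
  exact: (@closed_cvg _ _ F _ (ev t) _ cl (near t e e0) _ (cvt t)).
have zg e n : 0 < e -> gauge_le n (2 * e) (fun t => val (c e) t - z t).
  (* With [y] close to both [c e] and [c d], the part [c e - y] costs [e], and the rest has sup norm
     at most [4 * d], which the ball absorbs at cost [e]. *)
  move=> e0; pose d := e / 2 ^+ n / 4.
  have d0 : 0 < d by rewrite !divr_gt0.
  have [y [/ballE y1 /ballE y2]] := filter_ex (filterI (cP e e0) (cP d d0)).
  rewrite (_ : (fun t => _) =
      (fun t => val (c e - y) t + (val (y - c d) t + (val (c d) t - z t)))); last first.
    apply/funext => t; rewrite !interp_valB.
    ring.
  rewrite mulrDl !mul1r; apply: gauge_leD; first exact: interp_norm_lt.
  apply: gauge_le_small => [t|]; last exact: ltW.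
  have -> : e / 2 ^+ n = 2 * d + 2 * d by rewrite /d; field; rewrite gt_eqF.
  apply: le_trans (ler_normD _ _) _; apply: lerD; last exact: zP.
  apply: le_trans (interp_sup_le (y - c d) t) _.
  by rewrite ler_pM2l// -interp_normE distrC ltW.
have Xz : (z : K -> R^o) \in interp_pred.
  apply/asboolP => e e0; have e40 : 0 < e / 4 by rewrite divr_gt0.
  have := interp_valP (c (e / 4)); move/asboolP => /(_ _ e40)[N NP].
  exists N => n Nn; have := gauge_leD (NP n Nn) (gauge_leZ (-1) (zg _ n e40)).
  rewrite normrN1 mul1r => /(@le_gauge_le _ _ e).
  rewrite (_ : (fun t => _) = z); first by apply; lra.
  by apply/funext => t; rewrite mulN1r opprB addrC subrK.
apply/cvg_ex; exists (Interp Xz); apply/cvg_ballP => e e0.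
have e40 : 0 < e / 4 by rewrite divr_gt0.
apply: filterS (cP _ e40) => y /ballE cy; rewrite -ball_normE /=.
have h : `|Interp Xz - c (e / 4)| <= 2 * (e / 4).
  by rewrite distrC; apply: interp_norm_le => n; exact: zg.
apply: le_lt_trans (ler_distD (c (e / 4)) _ _) _.
apply: lt_le_trans (ler_ltD h cy) _.
by move: (e : R) e0 => r r0; lra.
Qed.

HB.instance Definition _ := Uniform_isComplete.Build interp interp_complete.

End gauge.

(** * The unit vectors of l1 *)

Section ell1_basis.
Variable R : realType.

Lemma nneseries_finite_support (f : nat -> R) n :
  (forall k, 0 <= f k) -> (forall k, (n <= k)%N -> f k = 0) ->
  (\sum_(k <oo) (f k)%:E = (\sum_(k < n) f k)%:E)%E.
Proof.
move=> f0 fn; rewrite (nneseries_split 0 n) => [|k _]; last by rewrite lee_fin.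
rewrite add0n eseries0 => [|k nk _]; last by rewrite fn.
by rewrite adde0 big_mkord sumEFin.
Qed.

Lemma ell1_basis_subproof (k : nat) :
  (fun i => (i == k)%:R : R) \in Lfun (@counting nat R) 1%E.
Proof.
apply/andP; split; rewrite inE//=.
rewrite /finite_norm Lnorm_counting// invr1 poweRe1; last first.
  by apply: nneseries_ge0 => *; exact: poweR_ge0.
rewrite (@eq_eseriesr _ _ (fun i => (i == k)%:R%:E)) => [|i _]; last first.
  by rewrite poweRe1// gee0_abs// lee_fin.
rewrite (@nneseries_finite_support (fun i => (i == k)%:R) k.+1) ?ltry// => i ki.
by rewrite gtn_eqF.
Qed.

Definition ell1_basis k : ell1 R := Lfun_Sub (lexx 1%E) (ell1_basis_subproof k).

Lemma ell1_norm_comb (n : nat) (a : nat -> R) :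
  `|\sum_(k < n) a k *: ell1_basis k| = \sum_(k < n) `|a k|.
Proof.
have E i : (\sum_(k < n) a k *: ell1_basis k) i = if (i < n)%N then a i else 0.
  elim: n => [|n IH]; first by rewrite big_ord0.
  rewrite big_ord_recr/=.
  rewrite -[LHS]/((\sum_(k < n) a k *: ell1_basis k) i + a n * (i == n)%:R) IH.
  rewrite [in RHS]ltnS [in RHS]leq_eqVlt; have [->|ni] := eqVneq i n.
    by rewrite ltnn mulr1 add0r.
  by rewrite mulr0 addr0.
apply/EFin_inj; rewrite -[LHS]/((ell1_norm _)%:E) EFin_ell1_norm.
under eq_eseriesr do rewrite E abse_EFin.
rewrite (@nneseries_finite_support _ n) => [|//|k nk]; last first.
  by rewrite ltnNge nk normr0.
by congr EFin; apply: eq_bigr => k _; rewrite ltn_ord.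
Qed.

(** The images of the unit vectors: continuity bounds them, and openness onto the range bounds [T]
    from below. *)
Lemma contains_ell1_sequence (X : normedModType R) : contains_ell1 X ->
  exists (x : nat -> X) (C delta : R), [/\ 0 < delta, forall k, `|x k| <= C &
    forall n (a : nat -> R),
      delta * \sum_(k < n) `|a k| <= `|\sum_(k < n) a k *: x k|].
Proof.
move=> [T [Tinj Tcont Topen]].
have T0 : T 0 = 0 by exact: linear0.
have [d d0 dP] : exists2 d : R, 0 < d & forall a, `|a| <= d -> `|T a| <= 1.
  have /cvgrPdist_le/(_ 1 ltr01) := Tcont 0; rewrite T0.
  move=> /nbhs_normP[d /= d0 dP]; exists (d / 2); first by rewrite divr_gt0.
  move=> a ad; have := dP a; rewrite /ball_ /= !sub0r !normrN; apply.
  by apply: le_lt_trans ad _; rewrite ltr_pdivrMr// ltr_pMr// ltr1n.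
have [r r0 rP] : exists2 r : R, 0 < r & forall a, `|T a| < r -> `|a| < 1.
  have [V oV VE] := Topen (ball (0 : ell1 R) 1) (ball_open _ _).
  have V0 : V 0.
    have : (T @` ball (0 : ell1 R) 1) 0 by exists 0; [exact: ballxx|].
    by rewrite VE => -[].
  have /nbhs_normP[r /= r0 rV] := open_nbhs_nbhs (conj oV V0).
  exists r => // a ar.
  have : (range T `&` V) (T a).
    by split; [exists a|apply: rV; rewrite /ball_ /= sub0r normrN].
  by rewrite -VE => -[b /= + /Tinj <-]; rewrite -ball_normE /ball_ /= sub0r normrN.
have ra a : r * `|a| <= `|T a|.
  rewrite leNgt; apply/negP => lt.
  have a0 : 0 < `|a|.
    rewrite normr_gt0; apply/eqP => a0; move: lt.
    by rewrite a0 T0 !normr0 mulr0 ltxx.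
  have := rP (`|a|^-1 *: a); rewrite linearZ !normrZ normfV normr_id mulVf ?gt_eqF//.
  by rewrite ltxx mulrC ltr_pdivrMr// => /(_ lt).
exists (fun k => T (ell1_basis k)), d^-1, r; split=> // [k|n a].
  have e1 : `|ell1_basis k| = 1.
    have := @ell1_norm_comb k.+1 (fun i => (i == k)%:R).
    rewrite big_ord_recr/= eqxx scale1r big1 ?add0r => [->|i _]; last first.
      by rewrite ltn_eqF// scale0r.
    rewrite big_ord_recr/= eqxx normr1 big1 ?add0r// => i _.
    by rewrite ltn_eqF// normr0.
  have := dP (d *: ell1_basis k); rewrite linearZ !normrZ e1 mulr1 gtr0_norm//.
  by rewrite lexx mulrC -ler_pdivlMr// div1r => /(_ isT).
rewrite -ell1_norm_comb; apply: le_trans (ra _) _.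
by rewrite linear_sum; under eq_bigr do rewrite linearZ.
Qed.

End ell1_basis.

(** * The interpolation space contains no copy of l1 *)

Section interp_no_ell1.
Variables (R : realType) (K : topologicalType) (W : nat -> set (set K)).

Lemma interp_val_sum n (a : nat -> R) (x : nat -> interp R W) t :
  val (\sum_(k < n) a k *: x k) t = \sum_(k < n) a k * val (x k) t :> R.
Proof.
elim: n => [|n IH]; first by rewrite !big_ord0.
by rewrite !big_ord_recr/= -IH.
Qed.

(* Gliding hump: if the sup norm were not bounded below on the blocks of x,
   sums of J successive blocks small in more and more of the gauges would have
   norm at most C + 1 + J * delta / 2, but it is at least J * delta. *)
Lemma interp_ell1_sup_norm (x : nat -> interp R W) (C delta : R) :
  0 < delta -> (forall k, `|x k| <= C) ->
  (forall n (a : nat -> R),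
     delta * \sum_(k < n) `|a k| <= `|\sum_(k < n) a k *: x k|) ->
  exists m (eta : R), 0 < eta /\ forall n (a : nat -> R), exists t,
    eta * \sum_(k < n) `|a k| <= `|\sum_(k < n) a k * val (x (m + k)%N) t|.
Proof.
move=> delta0 xC low; apply: contrapT => H.
have small m eta : 0 < eta -> exists n (a : nat -> R),
    \sum_(k < n) `|a k| = 1 /\
    forall t, `|val (\sum_(k < n) a k *: x (m + k)%N) t| <= eta.
  move=> eta0; have [[t0 _]|nK] := pselect (exists t : K, True); last first.
    exists 1%N, (fun=> 1); rewrite big_ord_recr big_ord0/= normr1 add0r.
    by split=> // t; exfalso; apply: nK; exists t.
  have [n [a lt]] : exists n (a : nat -> R), forall t,
      `|\sum_(k < n) a k * val (x (m + k)%N) t| < eta * \sum_(k < n) `|a k|.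
    apply: contrapT => nlt; apply: H; exists m, eta; split=> // n a.
    apply: contrapT => nle; apply: nlt; exists n, a => t.
    by rewrite ltNge; apply/negP => le; apply: nle; exists t.
  set s := \sum_(k < n) `|a k| in lt.
  have s0 : 0 < s.
    by have := le_lt_trans (normr_ge0 _) (lt t0); rewrite pmulr_rgt0.
  exists n, (fun k => s^-1 * a k); split=> [|t].
    under eq_bigr do rewrite normrM gtr0_norm ?invr_gt0//.
    by rewrite -mulr_sumr mulVf// gt_eqF.
  rewrite (interp_val_sum _ (fun k => s^-1 * a k) (fun k => x (m + k)%N)).
  under eq_bigr do rewrite -mulrA.
  rewrite -mulr_sumr normrM gtr0_norm ?invr_gt0// ler_pdivrMl// mulrC.
  exact: ltW.
pose e := delta / 2; have e0 : 0 < e by rewrite divr_gt0.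
have block J : exists n (a : nat -> R), \sum_(k < n) `|a k| = J%:R /\
    forall l, gauge_le W l (C + 1 + J%:R * e) (val (\sum_(k < n) a k *: x k)).
  elim: J => [|J [N [A [AJ zA]]]].
    exists 0%N, (fun=> 0); rewrite !big_ord0; split=> // l.
    apply: gauge_le_small => [t|]; rewrite mul0r addr0; last first.
      by have := le_trans (normr_ge0 _) (xC 0%N); lra.
    rewrite normr0 divr_ge0 ?exprn_ge0//.
    by have := le_trans (normr_ge0 _) (xC 0%N); lra.
  set z := \sum_(k < N) _ in zA.
  have [M zM] := asboolP _ (interp_valP z) e e0.
  have eM0 : 0 < e / 2 ^+ M by rewrite divr_gt0// exprn_gt0.
  have [n [a [a1 ya]]] := small N _ eM0.
  set y := \sum_(k < n) _ in ya.
  have yC l : gauge_le W l (C + 1) (val y).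
    apply: interp_norm_lt; rewrite -interp_normE.
    apply: (@le_lt_trans _ _ C); last by rewrite ltrDl.
    apply: le_trans (ler_norm_sum _ _ _) _; rewrite -[C]mul1r -a1 mulr_suml.
    by apply: ler_sum => k _; rewrite normrZ ler_wpM2l.
  exists (N + n)%N, (fun k => if (k < N)%N then A k else a (k - N)%N); split.
    rewrite big_split_ord/= -(natr1 J) -AJ -a1; congr (_ + _).
      by apply: eq_bigr => k _; rewrite ltn_ord.
    by apply: eq_bigr => k _; rewrite ltnNge leq_addr/= addKn.
  move=> l; rewrite big_split_ord/=.
  rewrite (_ : \sum_(i < N) _ = z); last first.
    by apply: eq_bigr => k _; rewrite ltn_ord.
  rewrite (_ : \sum_(i < n) _ = y); last first.
    by apply: eq_bigr => k _; rewrite ltnNge leq_addr/= addKn.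
  rewrite -[J.+1]addn1 natrD mulrDl mul1r.
  (* For [l >= M] the old sum [z] costs only [e]; for [l < M] the new block does, its sup norm being
     at most [e / 2 ^+ M]. *)
  have [Ml|lM] := leqP M l.
    apply: (@le_gauge_le _ _ _ _ (e + (C + 1))); last first.
      by apply: gauge_leD => //; exact: zM.
    rewrite addrC addrA lerD2r lerDl mulr_ge0//; exact: ltW.
  rewrite addrA; apply: gauge_leD => //; apply: gauge_le_small => [t|]; last exact: ltW.
  apply: le_trans (ya t) _; rewrite ler_pM2l// lef_pV2 ?posrE ?exprn_gt0//.
  by apply: ler_weXn2l; [rewrite ler1n|exact: ltnW].
(* Chosen so that [C + 1 < J%:R * e], whence [J%:R * delta] exceeds the upper bound from [block]. *)
pose J := (Num.truncn ((C + 1) / e)).+1.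
have [n [a [aJ za]]] := block J.
have := low n a; rewrite aJ interp_normE => le.
have := le_trans le (interp_norm_le za).
have : C + 1 < J%:R * e by rewrite -ltr_pdivrMr//; exact: truncnS_gt.
by rewrite /e; lra.
Qed.

(** A gauge of large index approximates the sequence within [eta / 2] in sup norm by combinations of
    sets in a single [W n], of bounded weight; these keep the lower estimate with [eta / 2]. *)
Lemma interp_no_ell1 : compact [set: K] -> (forall n, W n `<=` @clopen K) ->
  (forall n, relatively_convergent (W n)) -> ~ contains_ell1 (interp R W).
Proof.
move=> cK Wclopen Wconv /contains_ell1_sequence[x [C [delta [delta0 xC low]]]].
have [m [eta [eta0 sup_low]]] := interp_ell1_sup_norm delta0 xC low.
have C1 : 0 < C + 1 by have := le_trans (normr_ge0 _) (xC 0%N); lra.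
have eta20 : 0 < eta / 2 by rewrite divr_gt0.
pose n := (Num.truncn ((C + 1) / (eta / 2))).+1.
have nP : (C + 1) / 2 ^+ n <= eta / 2.
  rewrite ler_pdivrMr ?exprn_gt0// mulrC -ler_pdivrMr//.
  apply: le_trans (ltW (truncnS_gt _)) _; rewrite -natrX ler_nat.
  exact/ltnW/ltn_expl.
have /choice[cs csP] j : exists cs, [/\ forall p, List.In p cs -> W n p.2,
    \sum_(p <- cs) `|p.1| <= (C + 1) * 2 ^+ n &
    forall t, `|val (x (m + j)%N) t - comb cs t| <= (C + 1) / 2 ^+ n].
  have : gauge_le W n (C + 1) (val (x (m + j)%N)).
    by apply: interp_norm_lt; apply: le_lt_trans (xC _) _; rewrite ltrDl.
  by [].
apply: (relatively_convergent_no_ell1 cK (Wclopen n) (Wconv n) (cs := cs)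
  (s := (C + 1) * 2 ^+ n) _ _ eta20).
- by move=> j; have [] := csP j.
- by move=> j; have [] := csP j.
move=> k a; have [t tP] := sup_low k a; exists t.
have : `|\sum_(j < k) a j * val (x (m + j)%N) t - \sum_(j < k) a j * comb (cs j) t|
    <= eta / 2 * \sum_(j < k) `|a j|.
  rewrite -sumrB; apply: le_trans (ler_norm_sum _ _ _) _; rewrite mulr_sumr.
  apply: ler_sum => j _; rewrite -mulrBr normrM mulrC ler_wpM2r//.
  by apply: le_trans nP; have [] := csP j.
move: tP; set u : R := \sum_(j < k) _ * val _ _.
set v : R := \sum_(j < k) _ * comb _ _; set w := \sum_(j < k) `|a j|.
move=> h1 h2; have := ler_normD (u - v) v; rewrite subrK => h3.
have : eta * w = eta / 2 * w + eta / 2 * w by rewrite -mulrDl -splitr.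
lra.
Qed.

End interp_no_ell1.

(** * Embedding of the compact space by evaluation *)

Lemma normed_lipschitz_continuous (R : realType) (X : normedModType R)
    (f : X -> R) (c : R) :
  0 < c -> (forall x y, `|f x - f y| <= c * `|x - y|) -> continuous f.
Proof.
move=> c0 fc x; apply/cvgrPdist_le => e e0.
have ec0 : 0 < e / c by rewrite divr_gt0.
apply: filterS (nbhsx_ballx x _ ec0) => y; rewrite -ball_normE /ball_ /= => xy.
by apply: le_trans (fc x y) _; rewrite mulrC -ler_pdivlMr// ltW.
Qed.

Section evaluation.
Variables (R : realType) (K : topologicalType) (W : nat -> set (set K)).
Hypothesis Wclopen : forall n, W n `<=` @clopen K.
Hypothesis Wmono : forall n, W n `<=` W n.+1.

Lemma comb_locally_constant (cs : seq (R * set K)) t :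
  (forall p, List.In p cs -> clopen p.2) ->
  \forall s \near t, comb cs s = comb cs t.
Proof.
elim: cs => [|p cs IH] clp; first by near=> s; rewrite /comb !big_nil.
have pnear : \forall s \near t, (\1_p.2 s : R) = \1_p.2 t.
  have [op cp] := clp p (or_introl erefl).
  have [pt|pt] := pselect (p.2 t).
    have : nbhs t p.2 by exact: open_nbhs_nbhs.
    by apply: filterS => s ps; rewrite !indicE !mem_set.
  have : nbhs t (~` p.2) by apply: open_nbhs_nbhs; split=> //; exact: closed_openC.
  by apply: filterS => s ps; rewrite !indicE !memNset.
have csnear := IH (fun q qcs => clp q (or_intror qcs)).
near=> s; rewrite /comb !big_cons.
rewrite (near pnear s)//; congr (_ + _).
exact: (near csnear s).
Unshelve. all: by end_near. Qed.

(** [x] is a uniform limit of combinations of clopen indicators, which are locally constant. *)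
Lemma continuous_interp (x : interp R W) : continuous (val x : K -> R).
Proof.
move=> t; apply/cvgrPdist_le => e e0.
have e20 : 0 < e / 2 by rewrite divr_gt0.
have [N NP] := asboolP _ (interp_valP x) _ e20.
have [cs [Wcs _ app]] := NP N (leqnn N).
have app' s : `|val x s - comb cs s| <= e / 2.
  apply: le_trans (app s) _; rewrite ler_pdivrMr ?exprn_gt0// ler_pMr//.
  by rewrite exprn_ege1// ler1n.
have := comb_locally_constant t (fun p pcs => @Wclopen N _ (Wcs p pcs)).
apply: filterS => s st; apply: le_trans (ler_distD (comb cs t) _ _) _.
by rewrite [leRHS]splitr lerD// -st distrC.
Qed.

(** From index [n] on the indicator is itself a generator of the hull, so its gauge of index [k] is
    at most [2^-k]. *)
Lemma interp_pred_indic n C : W n C -> (\1_C : K -> R^o) \in interp_pred W.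
Proof.
move=> WC; apply/asboolP => e e0.
have Wle k l : (k <= l)%N -> W k `<=` W l.
  elim: l => [|l IH]; first by rewrite leqn0 => /eqP ->.
  rewrite leq_eqVlt => /predU1P[->//|]; rewrite ltnS => /IH kl.
  exact: subset_trans (Wmono (n := l)).
pose N := (Num.truncn e^-1).+1.
exists (maxn n N) => k; rewrite geq_max => /andP[nk Nk].
exists [:: (1, C)]; split=> [p [<-|//]|/=|t].
- exact: Wle nk _ WC.
- rewrite big_seq1 normr1 -ler_pdivrMl// mulr1.
  apply: le_trans (ltW (truncnS_gt _)) _; rewrite -natrX ler_nat.
  by apply: leq_trans Nk _; exact/ltnW/ltn_expl.
- by rewrite /comb big_seq1 mul1r subrr normr0 divr_ge0 ?exprn_ge0// ltW.
Qed.

Lemma continuous_interp_eval t : continuous (fun x : interp R W => val x t : R).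
Proof.
apply: (@normed_lipschitz_continuous _ _ _ 2) => // x y.
exact: (interp_sup_le (x - y) t).
Qed.

Lemma dual_eval t : dual (interp R W) (fun x => val x t).
Proof. by split=> //; exact: continuous_interp_eval. Qed.

Definition eval_dual t : dual (interp R W) := SigSub (mem_set (dual_eval t)).

Lemma continuous_eval_dual : continuous eval_dual.
Proof.
apply: continuous_comp_initial; apply: continuous_ptws => x.
exact: continuous_interp.
Qed.

Lemma eval_dual_homeomorphic :
  compact_hausdorff K -> has_clopen_basis K ->
  (forall C, clopen C -> exists n, W n C) ->
  exists2 L : set (dual (interp R W)), compact L & homeomorphic K L.
Proof.
move=> [cK hK] [B Bclopen [_ Bbasis]] Wall.
have clopen_nbhs (t : K) A : nbhs t A -> exists C, [/\ clopen C, C t & C `<=` A].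
  by move=> tA; have [C [BC Ct] CA] := Bbasis t A tA; exists C; split=> //; exact: Bclopen.
have indicX C : clopen C -> exists x : interp R W, val x = \1_C :> (K -> R).
  by move=> /Wall[n /interp_pred_indic XC]; exists (Interp XC).
have einj : injective eval_dual.
  (* Each clopen neighbourhood [C] of [s] contains [t], since both evaluations agree at its
     indicator. *)
  move=> s t est; apply: hK => A D /clopen_nbhs[C [Cclopen Cs CA]] Dt.
  have [x xC] := indicX C Cclopen.
  have : val x s = val x t by exact: (congr1 (fun l => val l x) est).
  rewrite xC !indicE mem_set// => /esym/eqP; rewrite pnatr_eq1 eqb1 => /set_mem Ct.
  by exists t; split; [exact: CA|exact: nbhs_singleton].
pose L := range eval_dual.
have inL t : L (eval_dual t) by exists t.
pose f t : L := SigSub (mem_set (inL t)).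
have /choice[g gP] (l : L) : exists t, eval_dual t = val l.
  by have /set_mem[t _ tl] := valP l; exists t.
exists L.
  apply: continuous_compact => //; apply: continuous_subspaceT.
  exact: continuous_eval_dual.
exists f, g; split.
- by move=> t; apply: einj; rewrite gP.
- by move=> l; apply: val_inj; rewrite /= gP.
- apply: continuous_comp_initial; exact: continuous_eval_dual.
move=> l A /clopen_nbhs[C [Cclopen Cgl CA]].
have [x xC] := indicX C Cclopen.
(* Evaluation at the indicator of [C] is weak* continuous and positive exactly where [g] takes
   values in [C]; hence [g] is continuous. *)
pose ev (l : L) : R := (val (val l) : interp R W -> R) x.
have evc : continuous ev.
  move=> l'; apply: (@continuous_comp _ _ _ (fun l : L => val (val l)) (fun h => h x)).
    apply: (@continuous_comp _ _ _ (val : L -> _) val); exact: initial_continuous.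
  exact: ptws_eval_continuous.
have evE l' : ev l' = \1_C (g l') by rewrite -xC /ev -gP.
have : nbhs l (ev @^-1` [set r | 0 < r]).
  apply: evc; apply: open_nbhs_nbhs; split; first exact: open_gt.
  by rewrite /= evE indicE mem_set.
apply: filterS => l' /=; rewrite evE indicE ltr0n lt0b => /set_mem.
exact: CA.
Qed.

End evaluation.

Theorem theorem2p8 (R : realType) (K : topologicalType)
    (hK : compact_hausdorff K) (h0 : has_clopen_basis K) (hQ : QWRN R K) :
  WRN R K.
Proof.
have [W [Wmono Wclopen Wconv Wall]] := QWRN_clopen_filtration hK.1 hQ.
exists (interp R W); split; first exact: (interp_no_ell1 hK.1 Wclopen Wconv).
exact: (eval_dual_homeomorphic R Wclopen Wmono hK h0 Wall).
Qed.
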